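(* There exist numerical constants $c, C>0$ and positive numerical constants $\ell_q \le e^{\frac{3q}{2}\log q + Cq}$, one for every $q\in\mathbb{N}$, such that the following lower bound holds. Let $p\ge 2$, $p\in\mathbb{N}$, and let $\Delta, L_1, L_2,\ldots,L_p,\epsilon$ be positive. Assume additionally that $\epsilon\le (L_1^q/L_q)^{1/(q-1)}$ for each $q\in\{2,\ldots,p\}$. Then $$ \mathcal{T}_\epsilon\big(\mathcal{A}_{\mathrm{det}}^{(1)}\cup\mathcal{A}_{\mathrm{zr}}^{(1)},\ \mathcal{F}_{1:p}(\Delta,L_1,\ldots,L_p)\big)\ \ge\ c\cdot\Delta\cdot\min_{q\in\{2,\ldots,p\}}\left\{\left(\frac{L_1}{\ell_1}\right)^{\frac35-\frac{2}{5(q-1)}}\left(\frac{L_q}{\ell_q}\right)^{\frac{2}{5(q-1)}}\right\}\epsilon^{-8/5}. $$ Moreover, for $p=2$, $$ \mathcal{T}_\epsilon\big(\mathcal{A}_{\mathrm{det}}^{(1)}\cup\mathcal{A}_{\mathrm{zr}}^{(1)},\ \mathcal{F}_{1:2}(\Delta,L_1,L_2)\big)\ \ge\ c\cdot\Delta\left(\frac{L_1}{\ell_1}\right)^{3/7}\left(\frac{L_2}{\ell_2}\right)^{2/7}\epsilon^{-12/7}. $$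
   Context: Here $\mathbb{N}=\{1,2,\ldots\}$ and $\|\cdot\|$ is the Euclidean norm. Function class. A function $f:\mathbb{R}^d\to\mathbb{R}$ has $L_q$-Lipschitz $q$th order derivatives if it is $q$ times continuously differentiable and for every $x,v\in\mathbb{R}^d$ with $\|v\|=1$, the function $f_{x,v}(t)=f(x+tv)$ satisfies $|f_{x,v}^{(q)}(t)-f_{x,v}^{(q)}(t')|\le L_q|t-t'|$ for all $t,t'\in\mathbb{R}$. $\mathcal{F}_{1:p}(\Delta,L_1,\ldots,L_p)$ is the union over $d\in\mathbb{N}$ of the collections of $\mathcal{C}^\infty$ functions $f:\mathbb{R}^d\to\mathbb{R}$ with $f(0)-\inf_x f(x)\le\Delta$ and with $L_q$-Lipschitz $q$th order derivatives for every $q\in\{1,\ldots,p\}$. Algorithms. An algorithm $\mathsf{A}$ maps (separately for every dimension $d$) functions $f:\mathbb{R}^d\to\mathbb{R}$ to sequences of iterates $\mathsf{A}[f]=\{x^{(t)}\}_{t\in\mathbb{N}}$ in $\mathbb{R}^d$. $\mathcal{A}_{\mathrm{det}}^{(1)}$ (first-order deterministic algorithms) is the set of algorithms whose iterates have the form $x^{(i)}=\mathsf{A}^{(i)}\big(f(x^{(1)}),\nabla f(x^{(1)}),\ldots,f(x^{(i-1)}),\nabla f(x^{(i-1)})\big)$ for all $i\in\mathbb{N}$, with $\mathsf{A}^{(i)}$ a measurable mapping into $\mathbb{R}^d$ (depending on $d$ but not otherwise on $f$). For $v\in\mathbb{R}^d$ let $\mathrm{supp}(v)=\{i: v_i\ne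 0\}$. $\mathcal{A}_{\mathrm{zr}}^{(1)}$ (first-order zero-respecting algorithms) is the set of algorithms such that for every $d$ and $f:\mathbb{R}^d\to\mathbb{R}$ the iterates $\{x^{(t)}\}=\mathsf{A}[f]$ satisfy $\mathrm{supp}(x^{(t)})\subseteq\bigcup_{s<t}\mathrm{supp}(\nabla f(x^{(s)}))$ for each $t\in\mathbb{N}$ (in particular $x^{(1)}=0$). Complexity. $\mathsf{T}_\epsilon(\mathsf{A},f)=\inf\{t\in\mathbb{N}: \|\nabla f(x^{(t)})\|\le\epsilon\}$ where $\{x^{(t)}\}=\mathsf{A}[f]$ (infimum of the empty set is $\infty$), and for an algorithm class $\mathcal{A}$ and function class $\mathcal{F}$, $\mathcal{T}_\epsilon(\mathcal{A},\mathcal{F})=\inf_{\mathsf{A}\in\mathcal{A}}\sup_{f\in\mathcal{F}}\mathsf{T}_\epsilon(\mathsf{A},f)$. ''Numerical constant'' means independent of $p,\Delta,L_1,\ldots,L_p,\epsilon$. *)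

(* Defs.v *)
From HB Require Import structures.
From mathcomp Require Import all_boot all_order all_algebra.
From mathcomp Require Import all_classical all_reals all_analysis.
Set Implicit Arguments.
Unset Strict Implicit.
Unset Printing Implicit Defensive.
Import Order.TTheory GRing.Theory Num.Theory.
Import numFieldNormedType.Exports.
Local Open Scope classical_set_scope.
Local Open Scope ring_scope.

(* Not the library norm on matrices, which is the sup norm. *)
Definition enorm (R : realType) (d : nat) (v : 'rV[R]_d) : R :=
  Num.sqrt (\sum_(j < d) v 0 j ^+ 2).

Definition supp (R : realType) (d : nat) (v : 'rV[R]_d) : {set 'I_d} :=
  [set j | v 0 j != 0]%SET.

Definition partial (R : realType) (d : nat) (j : 'I_d) (f : 'rV[R]_d -> R)
  (x : 'rV[R]_d) : R :=
  'D_(delta_mx 0 j) f x.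

Definition grad (R : realType) (d : nat) (f : 'rV[R]_d -> R) (x : 'rV[R]_d) :
  'rV[R]_d :=
  \row_j partial j f x.

(* All partial derivatives of order at most k exist and are continuous. *)
Fixpoint Ck (R : realType) (d : nat) (k : nat) (f : 'rV[R]_d -> R) : Prop :=
  continuous f /\
  if k is k'.+1 then
    forall j : 'I_d,
      (forall x, derivable f x (delta_mx 0 j)) /\ Ck k' (partial j f)
  else True.

Definition Cinfty (R : realType) (d : nat) (f : 'rV[R]_d -> R) : Prop :=
  forall k, Ck k f.

Definition lipschitz_deriv (R : realType) (d : nat) (q : nat) (Lq : R)
  (f : 'rV[R]_d -> R) : Prop :=
  Ck q f /\
  forall x v : 'rV[R]_d, enorm v = 1 ->
  forall t t' : R,
    let fxv := fun s : R => f (x + s *: v) in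
    `|derive1n q fxv t - derive1n q fxv t'| <= Lq * `|t - t'|.

(* The members of dimension d.  The infimum is taken in the extended reals, so
   that functions unbounded below are excluded.  Only L 1, ..., L p matter. *)
Definition fclass (R : realType) (p : nat) (Delta : R) (L : nat -> R) (d : nat) :
  set ('rV[R]_d -> R) :=
  [set f | [/\ Cinfty f,
     ((f 0)%:E - ereal_inf [set (f x)%:E | x in setT] <= Delta%:E)%E &
     forall q : nat, (1 <= q <= p)%N -> lipschitz_deriv q (L q) f]].

(* Dimensions are positive: in algorithms and complexities they are written
   d.+1.  Iterates are numbered from 0: A d f t is the (t + 1)-st iterate. *)
Definition algorithm (R : realType) : Type :=
  forall d : nat, ('rV[R]_d.+1 -> R) -> nat -> 'rV[R]_d.+1.

Definition borel_fun (T U : ptopologicalType) (g : T -> U) : Prop :=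
  @measurable_fun _ _ (g_sigma_algebraType (@open T))
    (g_sigma_algebraType (@open U)) setT g.

(* The answers to the first i queries, as a point of (R * R^d)^i: row s is
   (f (x s), grad f (x s)). *)
Definition oracle_history (R : realType) (d : nat) (f : 'rV[R]_d -> R)
  (x : nat -> 'rV[R]_d) (i : nat) : 'M[R]_(i, 1 + d) :=
  \matrix_(s < i) row_mx (const_mx (f (x s))) (grad f (x s)).

(* The two classes constrain an algorithm only on differentiable inputs, since
   grad is meaningless on the others. *)
Definition Adet (R : realType) : set (algorithm R) :=
  [set A | forall d : nat,
    exists phi : forall i : nat, 'M[R]_(i, 1 + d.+1) -> 'rV[R]_d.+1,
      (forall i, borel_fun (phi i)) /\
      forall f : 'rV[R]_d.+1 -> R, (forall x, differentiable f x) ->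
      forall i, A d f i = phi i (oracle_history f (A d f) i)].

Definition Azr (R : realType) : set (algorithm R) :=
  [set A | forall (d : nat) (f : 'rV[R]_d.+1 -> R),
    (forall x, differentiable f x) ->
    forall t : nat,
      supp (A d f t) \subset (\bigcup_(s < t) supp (grad f (A d f s)))%SET].

Definition Teps (R : realType) (eps : R) (d : nat) (f : 'rV[R]_d -> R)
  (x : nat -> 'rV[R]_d) : \bar R :=
  ereal_inf [set t.+1%:R%:E | t in [set t : nat | enorm (grad f (x t)) <= eps]].

Definition complexity (R : realType) (eps : R) (cA : set (algorithm R))
  (cF : forall d : nat, set ('rV[R]_d -> R)) : \bar R :=
  ereal_inf
    [set ereal_sup
           [set Teps eps (projT2 df) (A (projT1 df) (projT2 df))
           | df in [set df : {d : nat & 'rV[R]_d.+1 -> R} |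
                    cF (projT1 df).+1 (projT2 df)]]
    | A in cA].

(* Main.v *)
From HB Require Import structures.
Require Import Defs.
From mathcomp Require Import all_boot all_order all_algebra.
From mathcomp Require Import all_classical all_reals all_analysis.
From mathcomp Require Import ring lra zify.
Import Order.TTheory GRing.Theory Num.Theory.
Import numFieldNormedType.Exports.
Local Open Scope classical_set_scope.
Local Open Scope ring_scope.
Set Implicit Arguments.
Unset Strict Implicit.
Unset Printing Implicit Defensive.

(** The lower bound is witnessed by scaled copies of a chain function.  For
    vectors u_0, ..., u_T put y_i = <u_i, x> / sigma and let f(x) be lambda
    sigma^2 times
      a/2 (y_0 - 1)^2 + 1/2 sum_(i < T) (y_(i+1) - y_i)^2
        + nu sum_(i < T) Upsilon_r(y_i).

    Information.  If y_j = 0 for all j >= s, then f(x) and grad f(x) depend on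
    u_0, ..., u_s only, and grad f(x) is a combination of these vectors.  Hence a
    zero-respecting algorithm, run on f with u_i the standard basis, has y_j = 0
    for all j >= t at its t-th iterate (counted from 0).  Against a deterministic
    algorithm the same is forced in dimension 2T + 2 by choosing u_t
    orthogonal to u_0, ..., u_(t-1) and to the iterates 0, ..., t: by induction,
    the choice of u_t does not change the earlier answers
    (det_resisting_frame, resisting_frame).  In both cases, at every iterate
    t < T the last two coordinates y_(T-1) and y_T vanish.

    Large gradients.  The components of the gradient along the u_i are
    lambda sigma g_i, where g_i is the increment of the slope e_i = y_(i-1) - y_i
    plus nu Upsilon_r'(y_i), and e_0 = a (1 - y_0).  Take nu = a^2.  Since
    Upsilon_r' <= 0 on ]-oo, 1], slopes below level 1 can only be decreased by
    the g_i; and since Upsilon_r' <= -1/16 on [1/2, 1] and on ]-oo, -1], a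
    chain that goes down from 1 acquires a slope of order a while crossing
    [1/2, 3/4], and keeps it for ever after.  So it cannot stop at
    y_(T-1) = y_T = 0 unless sum g_i^2 > 2^-24 a^3 (chain_nonlinear).  With
    nu = 0 the same conclusion holds as long as T a <= 1 (chain_quadratic).

    Smoothness.  The nonconvex term is
      Upsilon_r(s) = r^4 (z^2/2 + cos z - 1) - r^3 (z - sin z)  with z = s/r,
    whose derivatives of order q + 1 >= 2 are at most 3 r^(3-q) in absolute value:
    being trigonometric, it costs no factor growing with q, and the theorem
    holds with l_q = 1 for every q.  The function f is a sum of ridge functions
    psi_k(<w_k, x>), a class stable under partial derivatives, so that it is
    smooth, and its derivatives along lines are explicit.

    Parameters.  Let lambda = L_1/8, a = b^2, and let sigma be 64^2 eps /
    (lambda b^3), so that all gradients met before iterate T exceed eps.  The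
    budget f(0) - inf f <= Delta then permits T of order
    Delta L_1 b^2 / eps^2, provided that Delta L_1 b^4 is at least of order
    eps^2; otherwise the quadratic chain alone gives the larger bound
    sqrt(L_1 Delta) / eps, up to a constant (complexity_ge_rate).  The bound with
    exponent 8/5 comes from r = b^(-2), with b, up to a constant factor, the
    largest value allowed by the conditions on L_2, ..., L_p; the one with
    exponent 12/7 comes from r = 1 and b^7 = eps L_2 / L_1^2. *)

(** * Euclidean inner product and ridge functions *)

(** Standard inner product of row vectors. *)
Definition dot (R : realType) (d : nat) (w x : 'rV[R]_d) : R :=
  \sum_j w 0 j * x 0 j.

Lemma dotDr (R : realType) d (w x y : 'rV[R]_d) : dot w (x + y) = dot w x + dot w y.
Proof. by rewrite /dot -big_split; apply: eq_bigr => j _; rewrite mxE mulrDr. Qed.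

Lemma dotZr (R : realType) d (w x : 'rV[R]_d) a : dot w (a *: x) = a * dot w x.
Proof. by rewrite /dot mulr_sumr; apply: eq_bigr => j _; rewrite mxE mulrCA. Qed.

Lemma dotC (R : realType) d (w x : 'rV[R]_d) : dot w x = dot x w.
Proof. by apply: eq_bigr => j _; rewrite mulrC. Qed.

Lemma dotZl (R : realType) d (w x : 'rV[R]_d) a : dot (a *: w) x = a * dot w x.
Proof. by rewrite dotC dotZr dotC. Qed.

Lemma dotDl (R : realType) d (w x y : 'rV[R]_d) : dot (x + y) w = dot x w + dot y w.
Proof. by rewrite dotC dotDr !(dotC w). Qed.

Lemma dotBl (R : realType) d (w x y : 'rV[R]_d) : dot (x - y) w = dot x w - dot y w.
Proof. by rewrite -scaleN1r dotDl dotZl mulN1r. Qed.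

Lemma dot0l (R : realType) d (x : 'rV[R]_d) : dot 0 x = 0.
Proof. by rewrite /dot big1 // => j _; rewrite mxE mul0r. Qed.

Lemma dot0r (R : realType) d (x : 'rV[R]_d) : dot x 0 = 0.
Proof. by rewrite dotC dot0l. Qed.

Lemma dot_sumr (R : realType) d (I : finType) (w : 'rV[R]_d) (x : I -> 'rV[R]_d) :
  dot w (\sum_i x i) = \sum_i dot w (x i).
Proof.
by apply: (big_morph (dot w)) => [x1 x2|]; rewrite ?dotDr ?dot0r.
Qed.

Lemma dot_delta (R : realType) d (w : 'rV[R]_d) j : dot w (delta_mx 0 j) = w 0 j.
Proof.
rewrite /dot (bigD1 j) //= big1 ?addr0 => [|i ij]; rewrite mxE ?eqxx ?mulr1 //.
by rewrite (negbTE ij) andbF mulr0.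
Qed.

Lemma dot_ge0 (R : realType) d (x : 'rV[R]_d) : 0 <= dot x x.
Proof. by apply: sumr_ge0 => j _; rewrite -expr2 sqr_ge0. Qed.

Lemma dot_eq0 (R : realType) d (x : 'rV[R]_d) : dot x x = 0 -> x = 0.
Proof.
move=> /eqP; rewrite psumr_eq0 => [|j _]; last by rewrite -expr2 sqr_ge0.
move=> /allP h; apply/rowP => j; rewrite mxE; apply/eqP.
by have := h j (mem_index_enum _); rewrite /= mulf_eq0 orbb.
Qed.

Lemma enormE (R : realType) d (v : 'rV[R]_d) : enorm v = Num.sqrt (dot v v).
Proof. by congr Num.sqrt; apply: eq_bigr => j _; rewrite expr2. Qed.

Lemma enorm_eq1 (R : realType) d (v : 'rV[R]_d) : enorm v = 1 -> dot v v = 1.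
Proof.
rewrite enormE => h; rewrite -[LHS]sqr_sqrtr ?dot_ge0 // h.
by rewrite expr1n.
Qed.

Lemma continuous_bigsum (R : realType) (V : topologicalType) (I : finType)
  (h : I -> V -> R) :
  (forall i, continuous (h i)) -> continuous (fun x => \sum_i h i x).
Proof.
move=> hc.
have -> : (fun x => \sum_i h i x) = \sum_i h i.
  by apply/funext => y; rewrite fct_sumE.
elim/big_ind : _ => //; first by move=> x; exact: cvg_cst.
by move=> f1 f2 h1 h2 x; apply: continuousD; [exact: h1|exact: h2].
Qed.

Lemma dot_continuous (R : realType) d (w : 'rV[R]_d) : continuous (dot w).
Proof.
apply: continuous_bigsum => j x.
by apply: (@continuousM _ _ (cst (w 0 j)) (fun x : 'rV[R]_d => x 0 j));
  [exact: cst_continuous|exact: coord_continuous].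
Qed.

HB.instance Definition _ (R : realType) d (w : 'rV[R]_d) :=
  GRing.isLinear.Build R 'rV[R]_d R^o *:%R (dot w)
    (fun a x y => eq_trans (dotDr w (a *: x) y)
       (congr1 (fun t => t + dot w y) (dotZr w x a))).

Lemma is_derive_bigsum (R : realType) (V : normedModType R) (I : finType)
  (h : I -> V -> R) (x v : V) (dh : I -> R) :
  (forall i, is_derive x v (h i) (dh i)) ->
  is_derive x v (fun y => \sum_i h i y) (\sum_i dh i).
Proof.
move=> hd.
have -> : (fun y => \sum_i h i y) = \sum_i h i.
  by apply/funext => y; rewrite fct_sumE.
elim/big_ind2 : _ => //; first exact: is_derive_cst.
by move=> f1 y1 f2 y2 h1 h2; apply: is_deriveD.
Qed.

Lemma differentiable_bigsum (R : realType) (V : normedModType R) (I : finType)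
  (h : I -> V -> R) (x : V) :
  (forall i, differentiable (h i) x) -> differentiable (fun y => \sum_i h i y) x.
Proof.
move=> hd.
have -> : (fun y => \sum_i h i y) = \sum_i h i.
  by apply/funext => y; rewrite fct_sumE.
apply: (big_ind (fun f : V -> R => differentiable f x)) => //.
by move=> f1 f2 h1 h2; apply: differentiableD.
Qed.

(** A sequence of functions of one variable in which each is the derivative of the
    one before: the successive derivatives of [psi 0], carried along with it. *)
Definition tower (R : realType) (psi : nat -> R -> R) : Prop :=
  forall n (s : R), is_derive s 1 (psi n) (psi n.+1 s).

(** The sum over k of b_k psi_k(<w_k, x>), with the n-th derivative of each psi_k
    instead of psi_k.  A partial derivative only changes the coefficients b_k
    and increments n, whence smoothness by induction. *)
Definition ridge (R : realType) d (I : finType) (psi : I -> nat -> R -> R)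
  (w : I -> 'rV[R]_d) (b : I -> R) (n : nat) (x : 'rV[R]_d) : R :=
  \sum_k b k * psi k n (dot (w k) x).

Section Ridge.
Variables (R : realType) (d : nat) (I : finType).
Variables (psi : I -> nat -> R -> R) (w : I -> 'rV[R]_d).
Hypothesis hpsi : forall k, tower (psi k).

Lemma tower_differentiable k n s : differentiable (psi k n) s.
Proof. by apply/derivable1_diffP; have [] := hpsi k n s. Qed.

Lemma differentiable_dot (u : 'rV[R]_d) x : differentiable (dot u) x.
Proof. exact/linear_differentiable/dot_continuous. Qed.

Lemma differentiable_ridge b n x : differentiable (ridge psi w b n) x.
Proof.
apply: differentiable_bigsum => k.
apply: (@differentiableZ _ _ _ (fun y => psi k n (dot (w k) y))).
apply: (@differentiable_comp _ _ _ _ (dot (w k)) (psi k n)).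
  exact: differentiable_dot.
exact: tower_differentiable.
Qed.

Lemma continuous_ridge b n : continuous (ridge psi w b n).
Proof. by move=> x; apply/differentiable_continuous/differentiable_ridge. Qed.

Lemma is_derive_ridge b n x v :
  is_derive x v (ridge psi w b n)
    (\sum_k b k * dot (w k) v * psi k n.+1 (dot (w k) x)).
Proof.
apply: is_derive_bigsum => k.
rewrite -mulrA; apply: (@is_deriveZ _ _ _ (fun y => psi k n (dot (w k) y))).
have df : differentiable (psi k n \o dot (w k)) x.
  apply: differentiable_comp; first exact: differentiable_dot.
  exact: tower_differentiable.
apply: DeriveDef; first exact: diff_derivable.
rewrite (deriveE v df) diff_comp /=; last 2 first.
- exact: differentiable_dot.
- exact: tower_differentiable.
rewrite diff_lin; last exact: dot_continuous.
rewrite diff1E; last exact: tower_differentiable.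
by rewrite derive1E; have [_ ->] := hpsi k n (dot (w k) x).
Qed.

Lemma partial_ridge b n j :
  partial j (ridge psi w b n) = ridge psi w (fun k => b k * w k 0 j) n.+1.
Proof.
apply/funext => x; rewrite /partial.
have [_ ->] := is_derive_ridge b n x (delta_mx 0 j).
by apply: eq_bigr => k _; rewrite dot_delta.
Qed.

Lemma Ck_ridge m b n : Ck m (ridge psi w b n).
Proof.
elim: m b n => [|m IH] b n; split => //; try exact: continuous_ridge.
move=> j; split; first by move=> x; have [] := is_derive_ridge b n x (delta_mx 0 j).
by rewrite partial_ridge.
Qed.

Lemma Cinfty_ridge b n : Cinfty (ridge psi w b n).
Proof. by move=> m; exact: Ck_ridge. Qed.

Lemma grad_ridge b x :
  grad (ridge psi w b 0) x = \sum_k (b k * psi k 1%N (dot (w k) x)) *: w k.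
Proof.
apply/rowP => j; rewrite mxE partial_ridge /ridge summxE.
by apply: eq_bigr => k _; rewrite mxE mulrAC.
Qed.

Lemma derive1n_ridge_line b x v q :
  derive1n q (fun s : R => ridge psi w b 0 (x + s *: v)) =
  (fun s => \sum_k b k * dot (w k) v ^+ q * psi k q (dot (w k) x + s * dot (w k) v)).
Proof.
elim: q => [|q IH].
  rewrite derive1n0; apply/funext => s; apply: eq_bigr => k _.
  by rewrite expr0 mulr1 dotDr dotZr.
rewrite derive1nS IH; apply/funext => s; rewrite derive1E.
suff : is_derive s 1 (fun s0 : R => \sum_k b k * dot (w k) v ^+ q *
     psi k q (dot (w k) x + s0 * dot (w k) v))
   (\sum_k b k * dot (w k) v ^+ q.+1 * psi k q.+1 (dot (w k) x + s * dot (w k) v)).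
  by case=> _ ->.
apply: is_derive_bigsum => k.
rewrite exprSr mulrA -[_ * _ * psi _ _ _]mulrA.
apply: (@is_deriveZ _ _ _ (fun s0 : R => psi k q (dot (w k) x + s0 * dot (w k) v))).
rewrite mulrC.
apply: (@is_derive1_comp _ (psi k q) (fun s0 => dot (w k) x + s0 * dot (w k) v)).
  exact: hpsi.
set al := dot (w k) x; set be := dot (w k) v.
have : is_derive s 1 (cst al + id * cst be) (0 + (s *: 0 + be *: 1)).
  by apply: is_deriveD; apply: is_deriveM.
by rewrite /GRing.scale /= !(mulr0, mulr1, add0r).
Qed.

(** The q-th derivative along a line of direction v multiplies the k-th term by
    <w_k, v>^q, and its variation brings one more factor <w_k, v>. *)
Lemma lipschitz_deriv_ridge b q (Lq : R) (K : I -> R) :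
  (forall k, 0 <= b k) ->
  (forall k s t, `|psi k q s - psi k q t| <= K k * `|s - t|) ->
  (forall v : 'rV[R]_d, dot v v = 1 ->
     \sum_k b k * K k * `|dot (w k) v| ^+ q.+1 <= Lq) ->
  lipschitz_deriv q Lq (ridge psi w b 0).
Proof.
move=> b0 hK hL; split; first exact: Ck_ridge.
move=> x v /enorm_eq1 v1 t t' /=.
rewrite derive1n_ridge_line -sumrB.
apply: le_trans (ler_norm_sum _ _ _) _.
apply: (@le_trans _ _ ((\sum_k b k * K k * `|dot (w k) v| ^+ q.+1) * `|t - t'|)).
  rewrite mulr_suml; apply: ler_sum => k _.
  rewrite -mulrBr normrM normrM normrX (ger0_norm (b0 k)).
  rewrite [leRHS](_ : _ = b k * (`|dot (w k) v| ^+ q *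
     (K k * (`|dot (w k) v| * `|t - t'|)))); last by rewrite exprS; ring.
  rewrite -[leLHS]mulrA; apply: ler_wpM2l => //.
  apply: ler_wpM2l; first exact: exprn_ge0.
  apply: le_trans (hK _ _ _) _.
  rewrite -normrM (_ : _ + _ - _ = dot (w k) v * (t - t')) //; ring.
by apply: ler_wpM2r => //; exact: hL.
Qed.

End Ridge.

(** * Derivatives and elementary bounds in one variable *)

(* Pointwise forms of the differentiation rules: the rules for sums, products
   and compositions of functions do not unify with explicit lambda-terms. *)
Section Derive.
Variable R : realType.
Implicit Types (f g : R -> R) (x a b c : R).

Lemma is_derive_val f x a b : is_derive x 1 f a -> a = b -> is_derive x 1 f b.
Proof. by move=> h <-. Qed.

Lemma is_derive_fcst c x : is_derive x 1 (fun _ : R => c) 0.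
Proof. exact: is_derive_cst. Qed.

Lemma is_derive_fid x : is_derive x 1 (fun y : R => y) 1.
Proof. exact: is_derive_id. Qed.

Lemma is_derive_fadd f g x a b : is_derive x 1 f a -> is_derive x 1 g b ->
  is_derive x 1 (fun y => f y + g y) (a + b).
Proof. exact: is_deriveD. Qed.

Lemma is_derive_fopp f x a : is_derive x 1 f a -> is_derive x 1 (fun y => - f y) (- a).
Proof. exact: is_deriveN. Qed.

Lemma is_derive_fscale f x a c : is_derive x 1 f a ->
  is_derive x 1 (fun y => c * f y) (c * a).
Proof. exact: is_deriveZ. Qed.

Lemma is_derive_fexpr f x a n : is_derive x 1 f a ->
  is_derive x 1 (fun y => f y ^+ n.+1) (n.+1%:R * f x ^+ n * a).
Proof.
move=> h; have : is_derive x 1 (f ^+ n.+1) ((n.+1%:R * f x ^+ n) *: a).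
  exact: is_deriveX.
by rewrite exprfctE.
Qed.

Lemma is_derive_fcos f x a : is_derive x 1 f a ->
  is_derive x 1 (fun y => cos (f y)) (- sin (f x) * a).
Proof. by move=> h; apply: (@is_derive1_comp _ cos f). Qed.

Lemma is_derive_fsin f x a : is_derive x 1 f a ->
  is_derive x 1 (fun y => sin (f y)) (cos (f x) * a).
Proof. by move=> h; apply: (@is_derive1_comp _ sin f). Qed.

End Derive.

(* Reduces [is_derive x 1 f a], for f an explicit combination of the forms above,
   to the equality of [a] with the derivative computed by the rules.  Class
   resolution is disabled since the premises are themselves class instances. *)
Ltac is_der := eapply is_derive_val; [repeat first
  [ notypeclasses refine (is_derive_fcst _ _)
  | notypeclasses refine (is_derive_fid _)
  | notypeclasses refine (is_derive_fadd _ _)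
  | notypeclasses refine (is_derive_fopp _)
  | notypeclasses refine (is_derive_fcos _)
  | notypeclasses refine (is_derive_fsin _)
  | notypeclasses refine (is_derive_fexpr _ _)
  | notypeclasses refine (is_derive_fscale _ _)] | rewrite ?/idfun ?/id /=].

Section Monotone.
Variable R : realType.
Implicit Types f df : R -> R.

Lemma ler_of_derive_ge0 f df (a b : R) : (forall x : R, is_derive x 1 f (df x)) ->
  a <= b -> (forall x, a <= x <= b -> 0 <= df x) -> f a <= f b.
Proof.
move=> hd; rewrite le_eqVlt => /predU1P[-> //|ab] h.
have [|] := @MVT _ f df a b ab (fun x _ => hd x).
  apply: continuous_subspaceT => x; apply: differentiable_continuous.
  by apply/derivable1_diffP; have [] := hd x.
move=> c cab e; rewrite -subr_ge0 e mulr_ge0 ?subr_ge0 ?(ltW ab) //.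
by apply: h; move: cab; rewrite in_itv /= => /andP[/ltW -> /ltW ->].
Qed.

Lemma ge0_of_derive_ge0 f df : (forall x : R, is_derive x 1 f (df x)) -> f 0 = 0 ->
  (forall x, 0 <= x -> 0 <= df x) -> forall x, 0 <= x -> 0 <= f x.
Proof.
move=> hd f0 h x x0; rewrite -f0; apply: (ler_of_derive_ge0 hd x0) => y /andP[y0 _].
exact: h.
Qed.

(* The Taylor bounds for sin and cos follow from each other by integration. *)

Lemma sin_le_id (y : R) : 0 <= y -> sin y <= y.
Proof.
move=> y0; rewrite -subr_ge0.
apply: (@ge0_of_derive_ge0 (fun y => y - sin y) (fun y => 1 - cos y)) y y0.
- by rewrite [sin 0]sin0 subrr.
- by move=> x _; rewrite subr_ge0 cos_le1.
Qed.

Lemma cos_ge2 (y : R) : 0 <= y -> 1 - y ^+ 2 / 2 <= cos y.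
Proof.
move=> y0; rewrite -subr_ge0.
suff : 0 <= cos y + - 1 + 2^-1 * y ^+ 2 by lra.
apply: (@ge0_of_derive_ge0 (fun y => cos y + - 1 + 2^-1 * y ^+ 2)
  (fun y => y - sin y)) y y0.
- by move=> x; is_der; field.
- by rewrite cos0; field.
- by move=> x x0; rewrite subr_ge0 sin_le_id.
Qed.

Lemma sin_ge3 (y : R) : 0 <= y -> y - y ^+ 3 / 6 <= sin y.
Proof.
move=> y0; rewrite -subr_ge0.
suff : 0 <= sin y + - y + 6^-1 * y ^+ 3 by lra.
apply: (@ge0_of_derive_ge0 (fun y => sin y + - y + 6^-1 * y ^+ 3)
  (fun y => cos y - (1 - y ^+ 2 / 2))) y y0.
- by move=> x; is_der; field.
- by rewrite sin0; field.
- by move=> x x0; rewrite subr_ge0 cos_ge2.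
Qed.

Lemma cos_le4 (y : R) : 0 <= y -> cos y <= 1 - y ^+ 2 / 2 + y ^+ 4 / 24.
Proof.
move=> y0; rewrite -subr_ge0.
suff : 0 <= 1 + - cos y + - (2^-1 * y ^+ 2) + 24^-1 * y ^+ 4 by lra.
apply: (@ge0_of_derive_ge0
  (fun y => 1 + - cos y + - (2^-1 * y ^+ 2) + 24^-1 * y ^+ 4)
  (fun y => sin y - (y - y ^+ 3 / 6))) y y0.
- by move=> x; is_der; field.
- by rewrite cos0; field.
- by move=> x x0; rewrite subr_ge0 sin_ge3.
Qed.

Lemma sin_le5 (y : R) : 0 <= y -> sin y <= y - y ^+ 3 / 6 + y ^+ 5 / 120.
Proof.
move=> y0; rewrite -subr_ge0.
suff : 0 <= y + - sin y + - (6^-1 * y ^+ 3) + 120^-1 * y ^+ 5 by lra.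
apply: (@ge0_of_derive_ge0
  (fun y => y + - sin y + - (6^-1 * y ^+ 3) + 120^-1 * y ^+ 5)
  (fun y => 1 - y ^+ 2 / 2 + y ^+ 4 / 24 - cos y)) y y0.
- by move=> x; is_der; field.
- by rewrite sin0; field.
- by move=> x x0; rewrite subr_ge0 cos_le4.
Qed.

Lemma lipschitz_of_derive f df (K : R) : (forall x : R, is_derive x 1 f (df x)) ->
  (forall x, `|df x| <= K) -> forall s t, `|f s - f t| <= K * `|s - t|.
Proof.
move=> hd hK s t; wlog st : s t / t <= s.
  move=> H; have [|/ltW] := leP t s; first exact: H.
  by rewrite distrC (distrC s t); exact: H.
rewrite [`|s - t|]ger0_norm ?subr_ge0 // ler_norml.
have dK (x : R) : is_derive x 1 (fun y => K * y) K.
  by is_der; rewrite mulr1.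
have h1 x := is_derive_fadd (hd x) (dK x).
have h2 x := is_derive_fadd (dK x) (is_derive_fopp (hd x)).
apply/andP; split.
  suff : f t + K * t <= f s + K * s by lra.
  apply: (ler_of_derive_ge0 h1) => // x _.
  by have := hK x; rewrite ler_norml; lra.
suff : K * t + - f t <= K * s + - f s by lra.
apply: (ler_of_derive_ge0 h2) => // x _.
by have := hK x; rewrite ler_norml; lra.
Qed.

End Monotone.

(** Successive derivatives of (s - c)^2 / 2. *)
Definition sqt (R : realType) (c : R) (n : nat) (s : R) : R :=
  match n with 0 => 2^-1 * (s + - c) ^+ 2 | 1 => s + - c | 2 => 1 | _ => 0 end.

Lemma tower_sqt (R : realType) (c : R) : tower (sqt c).
Proof.
case=> [|[|[|n]]] s.
- by rewrite /=; is_der; field.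
- by rewrite /=; is_der; ring.
- exact: is_derive_fcst.
- exact: is_derive_fcst.
Qed.

Lemma sqt_lipschitz (R : realType) (c : R) q s t :
  `|sqt c q.+1 s - sqt c q.+1 t| <= (q == 0%N)%:R * `|s - t|.
Proof.
case: q => [|[|q]] /=; last 2 first.
- by rewrite subrr normr0 mul0r.
- by rewrite subrr normr0 mul0r.
by rewrite mul1r opprD addrACA subrr addr0.
Qed.

(** * The nonconvex potential *)

Section Ups.
Variable R : realType.
Implicit Types r s t x y : R.

(** Successive derivatives of the polynomial part r^2 s^2 / 2 - r^2 s - r^4. *)
Definition upspoly r n s : R :=
  match n with
  | 0 => r ^+ 2 * (2^-1 * s ^+ 2) + - (r ^+ 2 * s) + - r ^+ 4
  | 1 => r ^+ 2 * s + - r ^+ 2 | 2 => r ^+ 2 | _ => 0 end.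

(** Successive derivatives of the trigonometric part r^4 cos(s/r) + r^3 sin(s/r):
    each derivative divides by r and shifts the phase by pi/2. *)
Definition upstrig r n s : R :=
  r^-1 ^+ n * (r ^+ 4 * cos (r^-1 * s + n%:R * (pi / 2))
             + r ^+ 3 * sin (r^-1 * s + n%:R * (pi / 2))).

(** The n-th derivative of the potential
    r^4 (z^2/2 + cos z - 1) - r^3 (z - sin z), z = s/r. *)
Definition ups r n s : R := upspoly r n s + upstrig r n s.

Lemma is_derive_upstrig r n s : is_derive s 1 (upstrig r n) (upstrig r n.+1 s).
Proof.
rewrite /upstrig; is_der.
have -> : n.+1%:R * (pi / 2) = n%:R * (pi / 2) + pi / 2 :> R.
  by rewrite -[n.+1%:R]natr1 mulrDl mul1r.
by rewrite addrA cosDpihalf sinDpihalf [r^-1 ^+ n.+1]exprS; ring.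
Qed.

Lemma tower_ups r : tower (ups r).
Proof.
move=> n s; rewrite /ups; notypeclasses refine (is_derive_fadd _ _).
  case: n => [|[|[|n]]].
  - by rewrite /=; is_der; field.
  - by rewrite /=; is_der; ring.
  - exact: is_derive_fcst.
  - exact: is_derive_fcst.
exact: is_derive_upstrig.
Qed.

Lemma cos_sin_combo_le (A B y : R) : 0 <= A -> 0 <= B ->
  `|A * cos y + B * sin y| <= A + B.
Proof.
move=> A0 B0; apply: le_trans (ler_normD _ _) _; rewrite !normrM (ger0_norm A0) (ger0_norm B0).
by rewrite lerD // ler_piMr // ler_norml ?cos_geN1 ?cos_le1 ?sin_geN1 ?sin_le1.
Qed.

Lemma ups_lipschitz r q s t : 1 <= r ->
  `|ups r q.+1 s - ups r q.+1 t| <= 3 * r ^+ 3 * r^-1 ^+ q.+1 * `|s - t|.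
Proof.
move=> r1; have r0 : 0 < r by lra.
have tl : forall x, `|upstrig r q.+2 x| <= r^-1 ^+ q.+2 * (r ^+ 4 + r ^+ 3).
  have k0 : 0 <= r^-1 ^+ q.+2 by rewrite exprn_ge0 // invr_ge0 ltW.
  move=> x; rewrite /upstrig normrM (ger0_norm k0).
  by rewrite ler_wpM2l // cos_sin_combo_le // exprn_ge0 // ltW.
apply: (@lipschitz_of_derive _ (ups r q.+1) (ups r q.+2)); first exact: tower_ups.
move=> x; apply: le_trans (ler_normD _ _) _.
have e : r^-1 ^+ q.+2 * (r ^+ 4 + r ^+ 3) = r^-1 ^+ q.+1 * (r ^+ 3 + r ^+ 2).
  by rewrite (exprS _ q.+1); field; rewrite gt_eqF.
apply: le_trans (lerD (lexx _) (tl x)) _; rewrite e.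
case: q {tl e} => [|q] /=.
  rewrite expr1 ger0_norm ?exprn_ge0 ?(ltW r0) // (_ : r^-1 * _ = r ^+ 2 + r); last first.
    by field; rewrite gt_eqF.
  rewrite (_ : _ * r^-1 = 3 * r ^+ 2); last by field; rewrite gt_eqF.
  by have : r * 1 <= r * r; [rewrite ler_pM2l|rewrite expr2; lra].
rewrite normr0 add0r [leRHS]mulrC ler_wpM2l ?exprn_ge0 ?invr_ge0 ?(ltW r0) //.
rewrite (exprS r 2).
have h : 1 * r ^+ 2 <= r * r ^+ 2 by rewrite ler_wpM2r // sqr_ge0.
have : 0 <= r ^+ 2 by exact: sqr_ge0.
lra.
Qed.

Lemma ups0 r : ups r 0 0 = 0.
Proof.
rewrite /ups /upstrig /=; have -> : r^-1 * 0 + 0 * (pi / 2) = 0 by ring.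
by rewrite cos0 sin0; ring.
Qed.

(** For small y this is approximately x^3/6 - x^2/2 with x = r y: a double zero at
    the origin, negative up to about 3, then positive. *)
Lemma ups1E r y : 0 < r ->
  ups r 1 (r * y) = r ^+ 3 * (y - sin y) - r ^+ 2 * (1 - cos y).
Proof.
move=> r0; rewrite /ups /upstrig /= expr1 mul1r cosDpihalf sinDpihalf.
by rewrite mulKf ?gt_eqF //; field; rewrite gt_eqF.
Qed.

Lemma ups1_0 r : 0 < r -> ups r 1 0 = 0.
Proof. by move=> r0; rewrite -(mulr0 r) ups1E // sin0 cos0; ring. Qed.

Lemma sub_sin_homo y y' : y <= y' -> y - sin y <= y' - sin y'.
Proof.
have hd x : is_derive x 1 (fun z => z + - sin z) (1 - cos x) by is_der; ring.
by move=> h; apply: (ler_of_derive_ge0 hd h) => x _; rewrite subr_ge0 cos_le1.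
Qed.

Lemma ups1_le_sqr r x : 1 <= r -> 0 <= x -> x <= 1 -> ups r 1 x <= - (7 / 24) * x ^+ 2.
Proof.
move=> r1 x0 x1; have r0 : 0 < r by lra.
have [y -> {x x0 x1} [y0 y1]] : exists2 y, x = r * y & 0 <= y /\ r * y <= 1.
  exists (x / r); first by rewrite mulrC divfK ?gt_eqF.
  by rewrite divr_ge0 ?(ltW r0) // mulrC divfK ?gt_eqF.
rewrite ups1E //.
have h1 : r ^+ 3 * (y - sin y) <= r ^+ 3 * (y ^+ 3 / 6).
  by rewrite ler_wpM2l ?exprn_ge0 ?(ltW r0) //; have := sin_ge3 y0; lra.
have h2 : r ^+ 2 * (y ^+ 2 / 2 - y ^+ 4 / 24) <= r ^+ 2 * (1 - cos y).
  by rewrite ler_wpM2l ?exprn_ge0 ?(ltW r0) //; have := cos_le4 y0; lra.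
have z0 : 0 <= (r * y) ^+ 2 by exact: sqr_ge0.
have y1' : y <= 1 by nra.
have h3 : (r * y) ^+ 2 * (r * y) <= (r * y) ^+ 2 by rewrite ler_piMr.
have h4 : (r * y) ^+ 2 * y ^+ 2 <= (r * y) ^+ 2 by rewrite ler_piMr // expr_le1.
have -> : - (7 / 24) * (r * y) ^+ 2 = (r * y) ^+ 2 * 6^-1
   - ((r * y) ^+ 2 / 2 - (r * y) ^+ 2 / 24) by field.
apply: le_trans (lerB h1 h2) _.
rewrite (_ : r ^+ 3 * _ = (r * y) ^+ 2 * (r * y) * 6^-1); last by field.
rewrite (_ : r ^+ 2 * _ = (r * y) ^+ 2 / 2 - (r * y) ^+ 2 * y ^+ 2 / 24); last by field.
lra.
Qed.

Lemma ups1_neg r x : 0 < r -> x <= 0 -> ups r 1 x <= 0.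
Proof.
move=> r0 x0.
have -> : x = r * (x / r) by rewrite mulrC divfK ?gt_eqF.
have y0 : x / r <= 0 by rewrite pmulr_lle0 ?invr_gt0.
rewrite ups1E // subr_le0; apply: (@le_trans _ _ 0).
  rewrite mulr_ge0_le0 ?exprn_ge0 ?(ltW r0) //.
  by have := sub_sin_homo y0; rewrite sin0 subrr.
by rewrite mulr_ge0 ?exprn_ge0 ?(ltW r0) // subr_ge0 cos_le1.
Qed.

Lemma ups1_le0 r x : 1 <= r -> x <= 1 -> ups r 1 x <= 0.
Proof.
move=> r1 x1; have r0 : 0 < r by lra.
have [x0|/ltW x0] := leP x 0; first exact: ups1_neg.
by apply: le_trans (ups1_le_sqr r1 x0 x1) _; have := sqr_ge0 x; lra.
Qed.

Lemma ups1_window r x : 1 <= r -> 1 / 2 <= x -> x <= 1 -> ups r 1 x <= - (1 / 16).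
Proof.
move=> r1 x0 x1; apply: le_trans (ups1_le_sqr r1 _ x1) _; first lra.
nra.
Qed.

Lemma ups1_left r x : 1 <= r -> x <= -1 -> ups r 1 x <= - (1 / 16).
Proof.
move=> r1 x1; have r0 : 0 < r by lra.
have -> : x = r * (x / r) by rewrite mulrC divfK ?gt_eqF.
have y1 : x / r <= - r^-1 by rewrite -mulN1r ler_pM2r ?invr_gt0.
rewrite ups1E //.
have v0 : 0 <= r^-1 by rewrite invr_ge0 ltW.
have v1 : r^-1 <= 1 by rewrite invf_le1.
have rr : 0 < r ^+ 3 by exact: exprn_gt0.
have h : r ^+ 3 * (x / r - sin (x / r)) <= r ^+ 3 * - (19 / 120 * r^-1 ^+ 3).
  rewrite ler_pM2l //; apply: le_trans (sub_sin_homo y1) _.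
  rewrite sinN; have := sin_le5 v0.
  have : r^-1 ^+ 3 * r^-1 ^+ 2 <= r^-1 ^+ 3.
    by rewrite ler_piMr ?exprn_ge0 // expr_le1.
  by rewrite -exprD; lra.
have e : r ^+ 3 * - (19 / 120 * r^-1 ^+ 3) = - (19 / 120) by field; rewrite gt_eqF.
have : 0 <= r ^+ 2 * (1 - cos (x / r)).
  by rewrite mulr_ge0 ?exprn_ge0 ?(ltW r0) // subr_ge0 cos_le1.
by rewrite e in h; lra.
Qed.

Lemma ups1_ge r x : 1 <= r -> 0 <= x -> - (x ^+ 2 / 2) <= ups r 1 x.
Proof.
move=> r1 x0; have r0 : 0 < r by lra.
have e : x = r * (x / r) by rewrite mulrC divfK ?gt_eqF.
have y0 : 0 <= x / r by rewrite divr_ge0 ?(ltW r0).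
rewrite e ups1E // -e.
have h1 : 0 <= r ^+ 3 * (x / r - sin (x / r)).
  by rewrite mulr_ge0 ?exprn_ge0 ?(ltW r0) // subr_ge0 sin_le_id.
have h2 : r ^+ 2 * (1 - cos (x / r)) <= r ^+ 2 * ((x / r) ^+ 2 / 2).
  by rewrite ler_wpM2l ?exprn_ge0 ?(ltW r0) //; have := cos_ge2 y0; lra.
rewrite (_ : r ^+ 2 * ((x / r) ^+ 2 / 2) = x ^+ 2 / 2) in h2; last first.
  by field; rewrite gt_eqF.
lra.
Qed.

Lemma one_sub_cos_le y : 0 <= y -> y * (1 - cos y) <= 4 * (y - sin y).
Proof.
move=> y0; have [y2|/ltW y2] := leP y 2.
  have h1 := cos_ge2 y0; have h2 := sin_le5 y0.
  have h3 : y * (1 - cos y) <= y * (y ^+ 2 / 2) by rewrite ler_wpM2l //; lra.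
  have h4 : y ^+ 3 * y ^+ 2 <= y ^+ 3 * 4.
    rewrite ler_wpM2l ?exprn_ge0 // (_ : 4 = 2 ^+ 2 :> R); last by ring.
    by rewrite lerXn2r // nnegrE.
  have h5 : 0 <= y ^+ 3 by exact: exprn_ge0.
  rewrite -exprD /= in h4; rewrite mulrA -exprS in h3; lra.
have h1 := cos_geN1 y; have h2 := sin_le1 y.
have h3 : y * (1 - cos y) <= y * 2 by rewrite ler_wpM2l //; lra.
lra.
Qed.

(** Here r y = x >= 4, and [one_sub_cos_le] gives r (y - sin y) >= 1 - cos y. *)
Lemma ups1_ge0 r x : 1 <= r -> 4 <= x -> 0 <= ups r 1 x.
Proof.
move=> r1 x4; have r0 : 0 < r by lra.
have e : x = r * (x / r) by rewrite mulrC divfK ?gt_eqF.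
have y0 : 0 < x / r by rewrite divr_gt0 //; lra.
rewrite e ups1E //; move: e y0; set y := x / r => e y0.
have h := one_sub_cos_le (ltW y0).
have h1 : 0 <= y - sin y by rewrite subr_ge0 sin_le_id // ltW.
have h2 : 4 * (y - sin y) <= r * y * (y - sin y) by rewrite ler_wpM2r // -e.
have h3 : y * (1 - cos y) <= y * (r * (y - sin y)) by lra.
rewrite ler_pM2l // in h3.
rewrite (_ : _ - _ = r ^+ 2 * (r * (y - sin y) - (1 - cos y))); last by ring.
by rewrite mulr_ge0 ?exprn_ge0 ?(ltW r0) // subr_ge0.
Qed.

End Ups.

(** The minimum lies in [0, 4], where the derivative is at least -x^2/2; this gives
    the lower bound -64/6. *)
Lemma ups_ge (R : realType) (r x : R) : 1 <= r -> - 11 <= ups r 0 x.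
Proof.
move=> r1; have r0 : 0 < r by lra.
have hd (z : R) : is_derive z 1 (ups r 0) (ups r 1 z) := tower_ups r 0 z.
have [x0|/ltW x0] := leP x 0.
  have hN z := is_derive_fopp (hd z).
  have : - ups r 0 x <= - ups r 0 0.
    apply: (ler_of_derive_ge0 hN x0) => z /andP[_ z0].
    by rewrite oppr_ge0 ups1_neg.
  by rewrite ups0; lra.
have hc (z : R) : is_derive z 1 (fun t : R => ups r 0 t + 6^-1 * t ^+ 3)
    (ups r 1 z + z ^+ 2 / 2).
  by apply: is_derive_fadd; is_der; field.
have small t : 0 <= t -> - (t ^+ 3 / 6) <= ups r 0 t.
  move=> t0; have : ups r 0 0 + 6^-1 * 0 ^+ 3 <= ups r 0 t + 6^-1 * t ^+ 3.
    apply: (ler_of_derive_ge0 hc t0) => z /andP[z0 _].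
    by have := ups1_ge r1 z0; lra.
  by rewrite ups0 expr0n /=; lra.
have [x4|/ltW x4] := leP x 4.
  apply: le_trans (small x x0).
  have : x ^+ 3 <= 4 ^+ 3 by rewrite lerXn2r // nnegrE.
  by rewrite (_ : 4 ^+ 3 = 64); [lra|ring].
have : ups r 0 4 <= ups r 0 x.
  by apply: (ler_of_derive_ge0 hd x4) => z /andP[z4 _]; exact: ups1_ge0.
have := small 4 (ler0n _ _); rewrite (_ : 4 ^+ 3 = 64); [lra|ring].
Qed.

(** * Gradient of a chain with two vanishing last coordinates *)

Section Chain.
Variable R : realType.
Variables (a : R) (y W : nat -> R) (T : nat).
Hypothesis a01 : 0 < a <= 1.
Hypothesis yT : y T = 0.
Hypothesis yT1 : y T.+1 = 0.

(** The descent y_(i-1) - y_i of the chain at node i; at node 0 it is replaced by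
    the pull a (1 - y_0) towards the value 1. *)
Definition slope i : R := if i is i'.+1 then y i' - y i else a * (1 - y 0).
(** The i-th component of the gradient of the unscaled chain function, W_i being
    the contribution of the potential. *)
Definition resid i : R := slope i.+1 - slope i + W i.

Hypothesis resid_small :
  \sum_(0 <= i < T.+1) resid i ^+ 2 <= 64^-1 ^+ 4 * a ^+ 3.

(** A force at least D along n steps raises the slope by D n, up to an error from
    the residuals.  The latter are bounded below by
    g >= - (a^2/256^2 + 128^2 g^2/a^2), a case of the inequality between arithmetic
    and geometric means; the sum of the last terms is at most a/1024. *)
Lemma slope_drift s n D : (s + n <= T.+1)%N ->
  (forall i, (i < n)%N -> D <= - W (s + i)) ->
  slope s - a / 32 / 32 + (D - a ^+ 2 / 256 / 256) * n%:R <= slope (s + n).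
Proof.
move=> snT hD.
have a0 : 0 < a by case/andP: a01.
have a2 : 0 < a ^+ 2 by exact: exprn_gt0.
pose S m := \sum_(s <= i < m) resid i ^+ 2.
have step : slope s - S (s + n)%N * (128 ^+ 2 / a ^+ 2) + (D - a ^+ 2 / 256 / 256) * n%:R
    <= slope (s + n).
  elim: n snT hD => [|n IH] snT hD.
    by rewrite addn0 /S big_geq // mul0r mulr0 subr0 addr0.
  have := IH (leq_trans (_ : s + n <= s + n.+1)%N snT) (fun i hi => hD i (ltnW hi)).
  rewrite leq_add2l leqnSn => /(_ isT).
  rewrite addnS /S big_nat_recr ?leq_addr //= -natr1.
  have hDn := hD n (ltnSn n).
  set X := \sum_(_ <= _ < _) _.
  have -> : y (s + n) - y (s + n).+1 = slope (s + n) + resid (s + n) - W (s + n).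
    by rewrite /resid /=; ring.
  set g := resid _.
  have : - (a ^+ 2 / 256 / 256 + g ^+ 2 * (128 ^+ 2 / a ^+ 2)) <= g.
    rewrite -subr_ge0.
    rewrite (_ : _ - _ = (128 * g / a + a / 256) ^+ 2); first exact: sqr_ge0.
    by field; rewrite gt_eqF.
  lra.
apply: le_trans step; rewrite lerD2r lerD2l lerN2.
have S_le : S (s + n)%N <= 64^-1 ^+ 4 * a ^+ 3.
  apply: le_trans resid_small.
  rewrite (big_cat_nat (n := s)) //=; last exact: leq_trans (leq_addr _ _) snT.
  rewrite (big_cat_nat (m := s) (n := s + n)) ?leq_addr //=.
  rewrite addrCA lerDl addr_ge0 // sumr_ge0 // => i _; exact: sqr_ge0.
apply: (@le_trans _ _ (64^-1 ^+ 4 * a ^+ 3 * (128 ^+ 2 / a ^+ 2))).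
  by rewrite ler_wpM2r // divr_ge0 // ltW.
rewrite le_eqVlt; apply/orP; left; apply/eqP; field.
by rewrite gt_eqF.
Qed.

(** Without potential and for T a <= 1, every slope is small because the last one
    is zero.  Then y_0 is close to 1, as the first slope is a (1 - y_0), and to 0,
    as the sum of the other slopes. *)
Lemma chain_quadratic : (forall i, W i = 0) -> T.+1%:R * a <= 1 -> False.
Proof.
move=> W0 Ta; have /andP[a0 a1] := a01.
have sl i : (i <= T.+1)%N -> slope i <= a / 32 / 16.
  move=> iT; have := @slope_drift i (T.+1 - i) 0.
  rewrite subnKC // => /(_ (leqnn _)).
  have -> : slope T.+1 = 0 by rewrite /= yT yT1 subrr.
  have : (T.+1 - i)%:R * a <= 1.
    by apply: le_trans Ta; rewrite ler_pM2r // ler_nat leq_subr.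
  set N := (T.+1 - i)%:R => hN /(_ _) h.
  have {h} : slope i - a / 32 / 32 + (0 - a ^+ 2 / 256 / 256) * N <= 0.
    by apply: h => j _; rewrite W0 oppr0.
  have : (N * a) * a <= 1 * a by rewrite ler_pM2r.
  rewrite expr2; lra.
have y0s : y 0 = \sum_(0 <= i < T.+1) slope i.+1.
  have := telescope_sumr (fun i => - y i) (leq0n T.+1).
  rewrite yT1 oppr0 sub0r opprK => <-; apply: eq_bigr => i _ /=.
  by rewrite opprK addrC.
have : y 0 <= T.+1%:R * (a / 32 / 16).
  rewrite y0s big_mkord; apply: le_trans (ler_sum _ _) _.
    by move=> i _; apply: sl; rewrite ltn_ord.
  by rewrite sumr_const card_ord mulr_natl.
have h0 : a * (1 - y 0) <= a * (32^-1 / 16) by rewrite mulrA; exact: (sl 0%N isT).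
rewrite ler_pM2l // in h0.
lra.
Qed.

Variable V : R -> R.
Hypothesis WV : forall i, W i = a ^+ 2 * V (y i).
Hypothesis V_le0 : forall x, x <= 1 -> V x <= 0.
Hypothesis V_window : forall x, 1 / 2 <= x -> x <= 1 -> V x <= - (1 / 16).
Hypothesis V_left : forall x, x <= -1 -> V x <= - (1 / 16).

Let a0 : 0 < a. Proof. by case/andP: a01. Qed.
Let a1 : a <= 1. Proof. by case/andP: a01. Qed.

(** Below level -1 the force exceeds the drift, so that the descent goes on
    for ever. *)
Lemma slope_below s : (s <= T)%N -> y s <= -1 -> a / 32 / 32 <= slope s ->
  forall n, (s + n <= T.+1)%N -> forall i, (i <= n)%N ->
    slope s - a / 32 / 32 <= slope (s + i) /\ y (s + i) <= - 1.
Proof.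
move=> sT ys es; elim=> [|n IH] snT i.
  by rewrite leqn0 => /eqP ->; rewrite addn0; split => //; have := a0; lra.
have {}IH := IH (leq_trans (_ : s + n <= s + n.+1)%N snT).
rewrite leq_add2l leqnSn in IH; have {}IH := IH isT.
rewrite leq_eqVlt ltnS => /predU1P[->|/IH //].
have h := @slope_drift s n.+1 (a ^+ 2 / 16) snT.
have {}h : slope s - a / 32 / 32 + (a ^+ 2 / 16 - a ^+ 2 / 256 / 256) * n.+1%:R
    <= slope (s + n.+1).
  apply: h => j; rewrite ltnS => /IH[_ yj].
  rewrite WV -mulrN ler_wpM2l ?exprn_ge0 ?(ltW a0) //.
  by have := V_left yj; lra.
have h2 : 0 <= (a ^+ 2 / 16 - a ^+ 2 / 256 / 256) * n.+1%:R.
  by rewrite mulr_ge0 //; have := sqr_ge0 a; lra.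
have h3 : slope s - a / 32 / 32 <= slope (s + n.+1) by lra.
split=> //; have [_ yn] := IH _ (leqnn n).
move: h3; rewrite addnS /= => h3; lra.
Qed.

(** A slope a/32 below level 1 stays above 3a/128 as long as level -1 is not
    reached: this takes at most about 86/a steps, too few for the drift. *)
Lemma slope_mid s : (s <= T)%N -> y s <= 1 -> a / 32 <= slope s ->
  forall n, (s + n <= T.+1)%N -> (forall i, (i < n)%N -> -1 < y (s + i)) ->
  forall i, (i <= n)%N ->
    a * (3 / 128) <= slope (s + i) /\ y (s + i) <= 1 - i%:R * (a * (3 / 128)).
Proof.
move=> sT ys es; elim=> [|n IH] snT hy i.
  rewrite leqn0 => /eqP ->; rewrite addn0 mul0r subr0; split => //.
  by have := a0; lra.
have {}IH := IH (leq_trans (_ : s + n <= s + n.+1)%N snT)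
  (fun i hi => hy i (ltnW hi)).
rewrite leq_add2l leqnSn in IH; have {}IH := IH isT.
rewrite leq_eqVlt ltnS => /predU1P[->|/IH //].
have h := @slope_drift s n.+1 0 snT.
have {}h : slope s - a / 32 / 32 + (0 - a ^+ 2 / 256 / 256) * n.+1%:R
    <= slope (s + n.+1).
  apply: h => j; rewrite ltnS => /IH[_ yj].
  rewrite WV oppr_ge0 mulr_ge0_le0 ?exprn_ge0 ?(ltW a0) //.
  apply: V_le0; apply: le_trans yj _.
  by rewrite lerBlDr lerDl !mulr_ge0 // ltW // a0.
have [_ yn] := IH _ (leqnn n).
have yn1 := hy n (ltnSn n).
have h1 : n%:R * a <= 86 by lra.
have h2 : a * (n.+1%:R * a) <= a * 87.
  by rewrite ler_pM2l // -natr1 mulrDl; have := a1; lra.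
have h3 : a * (3 / 128) <= slope (s + n.+1).
  by move: h; rewrite expr2; have := a0; lra.
split=> //; move: h3; rewrite addnS /= -natr1 mulrDl => h3; lra.
Qed.

(** A chain which stops at y_T = y_(T+1) = 0 never has slope a/32 below level 1. *)
Lemma slope_lt_below_one s : (s <= T)%N -> y s <= 1 -> a / 32 <= slope s -> False.
Proof.
move=> sT ys es.
have eT : slope T.+1 = 0 by rewrite /= yT yT1 subrr.
have hs : (s + (T.+1 - s) = T.+1)%N by rewrite subnKC // ltnW.
have [hex|hnex] := pselect (exists n, (n < T.+1 - s)%N && (y (s + n) <= -1)).
  case: (ex_minnP hex) => m /andP[mT ym] hmin.
  have smT : (s + m <= T)%N by rewrite -ltnS -hs ltn_add2l.
  have [|em _] := slope_mid sT ys es (leqW smT) _ (leqnn m).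
    move=> i im; rewrite ltNge; apply/negP => yi.
    have := hmin i; rewrite yi (ltn_trans im mT) => /(_ isT).
    by rewrite leqNgt im.
  have em' : a / 32 / 32 <= slope (s + m) by have := a0; lra.
  have hT : (s + m + (T.+1 - (s + m)) = T.+1)%N by rewrite subnKC // ltnW.
  have [] := slope_below smT ym em' (eq_leq hT) (leqnn _).
  by rewrite hT eT; have := a0; lra.
have [|] := slope_mid sT ys es (eq_leq hs) _ (leqnn _).
  move=> i im; rewrite ltNge; apply/negP => yi.
  by apply: hnex; exists i; rewrite im.
by rewrite hs eT; have := a0; lra.
Qed.

(** If y_0 <= 3/4, the first slope is already a/4.  Otherwise the chain goes down
    from 3/4 to 1/2.  If all slopes met on the way are less than a/32, this takes
    at least 8/a steps, during which the force a^2/16 produces a larger slope. *)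
Lemma chain_nonlinear : False.
Proof.
have [y0|y0] := leP (y 0) (3 / 4).
  apply: (@slope_lt_below_one 0) => //; first lra.
  rewrite /= ler_wpM2l ?(ltW a0) //; lra.
have exm : exists m, (m <= T)%N && (y m <= 1 / 2).
  by exists T; rewrite leqnn yT; lra.
case: (ex_minnP exm) => m /andP[mT ym] hmin.
have m0 : (0 < m)%N.
  by rewrite lt0n; apply/eqP => m0; rewrite m0 in ym; lra.
have exk : exists k, (k < m)%N && (3 / 4 <= y k) by exists 0%N; rewrite m0 ltW.
have bk : forall k, (k < m)%N && (3 / 4 <= y k) -> (k <= m)%N.
  by move=> k /andP[/ltnW].
case: (ex_maxnP exk bk) => k /andP[km yk] hmax.
have yup i : (k < i)%N -> (i <= m)%N -> y i < 3 / 4.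
  move=> ki; rewrite leq_eqVlt => /predU1P[->|im]; first lra.
  rewrite ltNge; apply/negP => yi.
  by have := hmax i; rewrite im yi leqNgt ki => /(_ isT).
have ylo i : (i < m)%N -> 1 / 2 < y i.
  move=> im; rewrite ltNge; apply/negP => yi.
  by have := hmin i; rewrite yi (ltnW (leq_trans im mT)) leqNgt im => /(_ isT).
have slow i : (k < i)%N -> (i <= m)%N -> slope i < a / 32.
  move=> ki im; rewrite ltNge; apply/negP => si.
  apply: (@slope_lt_below_one i) => //; first exact: leq_trans im mT.
  by have := yup _ ki im; lra.
(* k is the last node above 3/4 before m, the first node below 1/2. *)
have [n nE] : exists n, m = (k.+1 + n)%N by exists (m - k.+1)%N; rewrite subnKC.
have drop : 1 / 4 <= n.+1%:R * (a / 32).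
  have : y k - y m <= n.+1%:R * (a / 32).
    have -> : y k - y m = \sum_(k <= i < m) slope i.+1.
      have := telescope_sumr (fun i => - y i) (ltnW km).
      rewrite opprK addrC => <-; apply: eq_bigr => i _ /=.
      by rewrite opprK addrC.
    rewrite big_seq; apply: le_trans (ler_sum _ _) _.
      move=> i; rewrite mem_index_iota => /andP[ki im].
      by apply/ltW/slow => //; exact: ki.
    rewrite -big_seq sumr_const_nat nE addSnnS addKn mulr_natl.
    exact: lexx.
  by lra.
have sk : 0 <= slope k.+1 by rewrite /= ; have := yup k.+1 (ltnSn k) km; lra.
have := @slope_drift k.+1 n (a ^+ 2 / 16).
rewrite -nE (leqW mT) => /(_ isT) h.
have {}h : slope k.+1 - a / 32 / 32 + (a ^+ 2 / 16 - a ^+ 2 / 256 / 256) * n%:R <= slope m.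
  apply: h => j jn; rewrite WV -mulrN ler_wpM2l ?exprn_ge0 ?(ltW a0) //.
  have jm : (k.+1 + j < m)%N by rewrite nE ltn_add2l.
  have kj : (k < k.+1 + j)%N by rewrite addSn ltnS leq_addr.
  have := V_window (ltW (ylo _ jm)).
  have yj := yup _ kj (ltnW jm).
  have -> : y (k.+1 + j) <= 1 by lra.
  by move=> /(_ isT); lra.
have sm := slow m km (leqnn m).
have an : 7 <= n%:R * a.
  by move: drop; rewrite -[n.+1%:R]natr1; have := a1; lra.
have : a * 7 <= a * (n%:R * a) by rewrite ler_pM2l.
by move: h; rewrite expr2; have := a0; lra.
Qed.

End Chain.

(** * The hard function *)

Lemma bessel (R : realType) d (u : nat -> 'rV[R]_d) (N : nat) (v : 'rV[R]_d) :
  (forall i j, (i < N)%N -> (j < N)%N -> dot (u i) (u j) = (i == j)%:R) ->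
  \sum_(i < N) dot (u i) v ^+ 2 <= dot v v.
Proof.
move=> ortho; set S := \sum_(i < N) _.
pose p := \sum_(i < N) dot (u i) v *: u i.
have pv : dot p v = S.
  rewrite dotC dot_sumr; apply: eq_bigr => i _.
  by rewrite dotZr dotC expr2 [dot v _]dotC.
have pp : dot p p = S.
  rewrite {2}/p dot_sumr; apply: eq_bigr => i _.
  rewrite dotZr [dot p _]dotC expr2; congr (_ * _).
  rewrite dot_sumr (bigD1 i) //= dotZr ortho // eqxx mulr1 big1 ?addr0 // => j ji.
  by rewrite dotZr ortho // eq_sym (negbTE (_ : (j : nat) != i)) ?mulr0.
have := dot_ge0 (v - p).
rewrite dotBl ![dot _ (v - p)]dotC !dotBl pp pv [dot v p]dotC pv.
lra.
Qed.

Section Hard.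
Variables (R : realType) (d T : nat) (u : nat -> 'rV[R]_d).
Variables (lam sig a nu r : R).

(** One term for the pull of y_0 towards 1, then the T links of the chain, then the
    T potentials. *)
Definition hard_index := ('I_1 + ('I_T + 'I_T))%type.

Definition hard_tower (k : hard_index) : nat -> R -> R :=
  match k with inl _ => sqt 1 | inr (inl _) => sqt 0 | inr (inr _) => ups r end.

Definition hard_dir (k : hard_index) : 'rV[R]_d :=
  sig^-1 *:
  match k with inl _ => u 0 | inr (inl i) => u i.+1 - u i | inr (inr i) => u i end.

Definition hard_coef (k : hard_index) : R :=
  lam * sig ^+ 2 * match k with inl _ => a | inr (inl _) => 1 | inr (inr _) => nu end.

(** lam sig^2 (a/2 (y_0 - 1)^2 + 1/2 sum_(i < T) (y_(i+1) - y_i)^2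
      + nu sum_(i < T) ups r 0 y_i)  with  y_i = <u_i, x> / sig. *)
Definition hard : 'rV[R]_d -> R := ridge hard_tower hard_dir hard_coef 0.

Lemma dot_hard_dir k v : dot (hard_dir k) v = sig^-1 *
  match k with
  | inl _ => dot (u 0) v
  | inr (inl i) => dot (u i.+1) v - dot (u i) v
  | inr (inr i) => dot (u i) v
  end.
Proof. by case: k => [k|[k|k]]; rewrite /hard_dir dotZl ?dotBl. Qed.

Lemma hard_towerP k : tower (hard_tower k).
Proof. by case: k => [?|[?|?]] /=; [exact: tower_sqt|exact: tower_sqt|exact: tower_ups]. Qed.

Lemma Cinfty_hard : Cinfty hard.
Proof. exact: Cinfty_ridge hard_towerP _ _. Qed.

Lemma differentiable_hard x : differentiable hard x.
Proof. exact: differentiable_ridge hard_towerP _ _ _. Qed.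

Lemma big_hard_index (F : hard_index -> R) :
  \sum_k F k = F (inl ord0) + (\sum_(i < T) F (inr (inl i)) + \sum_(i < T) F (inr (inr i))).
Proof. by rewrite big_sumType big_sumType big_ord1. Qed.

Hypothesis lam0 : 0 < lam.
Hypothesis sig0 : 0 < sig.
Hypothesis a01 : 0 <= a <= 1.
Hypothesis nu0 : 0 <= nu.
Hypothesis r1 : 1 <= r.

Let r0 : 0 < r. Proof. exact: lt_le_trans r1. Qed.
Let c0 : 0 < lam * sig ^+ 2. Proof. by rewrite mulr_gt0 // exprn_gt0. Qed.

Lemma hard_coef_ge0 k : 0 <= hard_coef k.
Proof.
rewrite /hard_coef mulr_ge0 ?(ltW c0) //; case: k => [_|[_|_]] //.
by case/andP: a01.
Qed.

Hypothesis ortho : forall i j, (i < T.+1)%N -> (j < T.+1)%N ->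
  dot (u i) (u j) = (i == j)%:R.

Lemma sum_sqr_diff_le (c : nat -> R) n :
  \sum_(i < n) (c i.+1 - c i) ^+ 2 <= 4 * \sum_(i < n.+1) c i ^+ 2.
Proof.
have h1 : \sum_(i < n) (c i.+1 - c i) ^+ 2 <=
    \sum_(i < n) (2 * c i.+1 ^+ 2 + 2 * c i ^+ 2).
  apply: ler_sum => i _; rewrite -subr_ge0.
  by rewrite (_ : _ - _ = (c i.+1 + c i) ^+ 2); [exact: sqr_ge0|ring].
apply: le_trans h1 _; rewrite big_split /= -!mulr_sumr.
have h2 : \sum_(i < n) c i.+1 ^+ 2 <= \sum_(i < n.+1) c i ^+ 2.
  by rewrite [leRHS]big_ord_recl lerDr sqr_ge0.
have h3 : \sum_(i < n) c i ^+ 2 <= \sum_(i < n.+1) c i ^+ 2.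
  by rewrite [leRHS]big_ord_recr lerDl sqr_ge0.
lra.
Qed.

(** Only the pull and the links, which are quadratic, and the potentials contribute
    for q = 1; for q >= 2 only the potentials do.  The factors <u_i, v> are
    controlled by the Bessel inequality. *)
Lemma hard_lipschitz (p : nat) (L : nat -> R) : nu * r ^+ 2 <= 1 -> 8 * lam <= L 1%N ->
  (forall q, (2 <= q.+1 <= p)%N -> 3 * lam * nu * r ^+ 2 / (r * sig) ^+ q <= L q.+1) ->
  forall q, (1 <= q <= p)%N -> lipschitz_deriv q (L q) hard.
Proof.
move=> nur L1 Lq [//|q] /andP[_ qp].
pose K (k : hard_index) : R :=
  match k with inr (inr _) => 3 * r ^+ 3 * r^-1 ^+ q.+1 | _ => (q == 0%N)%:R end.
apply: (@lipschitz_deriv_ridge _ _ _ _ _ hard_towerP _ _ _ K).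
- exact: hard_coef_ge0.
- move=> [?|[?|?]] s t; rewrite /K /=; [exact: sqt_lipschitz|exact: sqt_lipschitz|].
  exact: ups_lipschitz.
move=> v v1.
pose c i := dot (u i) v.
have c2 : \sum_(i < T.+1) c i ^+ 2 <= 1 by rewrite -v1; exact: bessel.
have cle i : (i < T.+1)%N -> c i ^+ 2 <= 1.
  move=> iT; apply: le_trans c2; rewrite (bigD1 (Ordinal iT)) //= lerDl.
  by apply: sumr_ge0 => j _; exact: sqr_ge0.
have c2' : \sum_(i < T) c i ^+ 2 <= 1.
  by apply: le_trans c2; rewrite [leRHS]big_ord_recr lerDl sqr_ge0.
have pw i : (i < T)%N -> `|c i| ^+ q.+2 <= c i ^+ 2.
  move=> iT; rewrite -[X in _ <= X]real_normK ?num_real // -(addn2 q) exprD.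
  rewrite ler_piMl ?exprn_ge0 // exprn_ile1 //.
  by rewrite -(@expr_le1 _ 2) // real_normK ?num_real // cle // ltnW.
have sp : \sum_(i < T) `|c i| ^+ q.+2 <= 1.
  by apply: le_trans c2'; apply: ler_sum => i _; exact: pw.
rewrite big_hard_index /hard_coef /K.
rewrite dot_hard_dir -/(c 0%N) normrM exprMn (gtr0_norm (_ : 0 < sig^-1)) ?invr_gt0 //.
have sumd : \sum_(i < T) lam * sig ^+ 2 * 1 * (q == 0%N)%:R *
    `|dot (hard_dir (inr (inl i))) v| ^+ q.+2 =
    lam * sig ^+ 2 * (q == 0%N)%:R * sig^-1 ^+ q.+2 *
      \sum_(i < T) `|c i.+1 - c i| ^+ q.+2.
  rewrite mulr_sumr; apply: eq_bigr => i _; rewrite dot_hard_dir normrM exprMn.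
  by rewrite (gtr0_norm (_ : 0 < sig^-1)) ?invr_gt0 // mulr1 mulrA.
have sumu : \sum_(i < T) lam * sig ^+ 2 * nu * (3 * r ^+ 3 * r^-1 ^+ q.+1) *
    `|dot (hard_dir (inr (inr i))) v| ^+ q.+2 =
    lam * sig ^+ 2 * nu * (3 * r ^+ 3 * r^-1 ^+ q.+1) * sig^-1 ^+ q.+2 *
      \sum_(i < T) `|c i| ^+ q.+2.
  rewrite mulr_sumr; apply: eq_bigr => i _; rewrite dot_hard_dir normrM exprMn.
  by rewrite (gtr0_norm (_ : 0 < sig^-1)) ?invr_gt0 // -[RHS]mulrA.
rewrite sumd sumu.
set X := \sum_(i < T) `|c i| ^+ q.+2 in sp *.
have rs0 : r * sig != 0 by rewrite mulf_neq0 // gt_eqF.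
have sne : sig != 0 by rewrite gt_eqF.
have rne : r != 0 by rewrite gt_eqF.
have e : lam * sig ^+ 2 * nu * (3 * r ^+ 3 * r^-1 ^+ q.+1) * sig^-1 ^+ q.+2 =
    3 * lam * nu * r ^+ 2 / (r * sig) ^+ q.
  rewrite -exprVn invfM exprMn !exprS; field.
  by rewrite sne rne.
rewrite e.
have e0 : 0 <= 3 * lam * nu * r ^+ 2 / (r * sig) ^+ q.
  rewrite divr_ge0 ?exprn_ge0 ?mulr_ge0 ?(ltW r0) ?(ltW sig0) ?(ltW lam0) //.
have eX : 3 * lam * nu * r ^+ 2 / (r * sig) ^+ q * X <= 3 * lam * nu * r ^+ 2 / (r * sig) ^+ q.
  by rewrite ler_piMr.
clear sumd sumu.
have [q0|q0] := eqVneq q 0%N; last first.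
  rewrite /= !mulr0 !mul0r !add0r.
  by apply: le_trans eX _; apply: Lq; rewrite ltnS lt0n q0.
subst q.
rewrite /= !mulr1.
have -> : \sum_(i < T) `|c i.+1 - c i| ^+ 2 = \sum_(i < T) (c i.+1 - c i) ^+ 2.
  by apply: eq_bigr => i _; rewrite real_normK // num_real.
rewrite real_normK ?num_real //.
have s2 := sum_sqr_diff_le c T.
have -> : lam * sig ^+ 2 * a * (sig^-1 ^+ 2 * c 0%N ^+ 2) = lam * (a * c 0%N ^+ 2).
  by field.
have -> : lam * sig ^+ 2 * sig^-1 ^+ 2 = lam by field.
have h1 : a * c 0%N ^+ 2 <= 1.
  by case/andP: a01 => a0 a1; rewrite mulr_ile1 ?sqr_ge0 // cle.
have h2 : lam * (a * c 0%N ^+ 2) <= lam * 1 by rewrite ler_pM2l.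
have h3 : lam * \sum_(i < T) (c i.+1 - c i) ^+ 2 <= lam * 4.
  by rewrite ler_pM2l //; lra.
have h4 : lam * (nu * r ^+ 2) <= lam * 1 by rewrite ler_pM2l.
move: eX; rewrite expr0 divr1; lra.
Qed.

Lemma hard_at0 : hard 0 = lam * sig ^+ 2 * (a / 2).
Proof.
rewrite /hard /ridge big_hard_index /= dot0r /hard_coef.
rewrite big1 => [|i _]; last by rewrite dot0r oppr0 addr0 expr0n /= !mulr0.
rewrite big1 => [|i _]; last by rewrite dot0r ups0 mulr0.
by field.
Qed.

Lemma hard_ge x : - (lam * sig ^+ 2 * (11 * nu * T%:R)) <= hard x.
Proof.
rewrite /hard /ridge big_hard_index /=.
have h1 : 0 <= hard_coef (inl ord0) *
    (2^-1 * (dot (hard_dir (inl ord0)) x - 1) ^+ 2).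
  by rewrite mulr_ge0 ?hard_coef_ge0 // mulr_ge0 ?sqr_ge0.
have h2 : 0 <= \sum_(i < T) hard_coef (inr (inl i)) *
    (2^-1 * (dot (hard_dir (inr (inl i))) x - 0) ^+ 2).
  by apply: sumr_ge0 => i _; rewrite mulr_ge0 ?hard_coef_ge0 // mulr_ge0 ?sqr_ge0.
have h3 : \sum_(i < T) - (lam * sig ^+ 2 * nu * 11) <=
   \sum_(i < T) hard_coef (inr (inr i)) * ups r 0 (dot (hard_dir (inr (inr i))) x).
  apply: ler_sum => i _; rewrite -mulrN ler_wpM2l ?(mulr_ge0 (ltW c0) nu0) //.
  exact: ups_ge.
rewrite sumr_const card_ord in h3.
have -> : - (lam * sig ^+ 2 * (11 * nu * T%:R)) = (- (lam * sig ^+ 2 * nu * 11)) *+ T.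
  by rewrite -[RHS]mulr_natl; ring.
apply: le_trans h3 _; rewrite addrA lerDr addr_ge0 //.
Qed.

Lemma hard_fclass (p : nat) (Delta : R) (L : nat -> R) : nu * r ^+ 2 <= 1 ->
  8 * lam <= L 1%N ->
  (forall q, (2 <= q.+1 <= p)%N -> 3 * lam * nu * r ^+ 2 / (r * sig) ^+ q <= L q.+1) ->
  lam * sig ^+ 2 * (a / 2 + 11 * nu * T%:R) <= Delta ->
  fclass p Delta L hard.
Proof.
move=> nur L1 Lq hD; split; [exact: Cinfty_hard| |exact: hard_lipschitz].
have h : ((- (lam * sig ^+ 2 * (11 * nu * T%:R)))%:E <=
    ereal_inf [set (hard x)%:E | x in setT])%E.
  by apply/ereal_infP => _ [x _ <-]; rewrite lee_fin hard_ge.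
apply: le_trans (leeB (lexx _) h) _.
rewrite hard_at0 -EFinB lee_fin opprK -mulrDr.
exact: hD.
Qed.

Lemma dot_grad_hard x j : (j < T)%N ->
  dot (u j) (grad hard x) = lam * sig *
   resid a (fun i => dot (u i) x / sig) (fun i => nu * ups r 1 (dot (u i) x / sig)) j.
Proof.
move=> jT; pose y i := dot (u i) x / sig; rewrite -/y.
have jT' : (j < T.+1)%N by exact: ltnW.
have sne : sig != 0 by rewrite gt_eqF.
rewrite /hard grad_ridge; last exact: hard_towerP.
rewrite dot_sumr big_hard_index.
have tm k : dot (u j) ((hard_coef k * hard_tower k 1 (dot (hard_dir k) x)) *: hard_dir k) =
    hard_coef k * hard_tower k 1 (dot (hard_dir k) x) * dot (hard_dir k) (u j).
  by rewrite dotZr [dot (u j) _]dotC.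
have -> : \sum_(i < T) dot (u j) ((hard_coef (inr (inl i)) *
    hard_tower (inr (inl i)) 1 (dot (hard_dir (inr (inl i))) x)) *: hard_dir (inr (inl i))) =
   \sum_(i < T) (lam * sig * (y i.+1 - y i) * (j == i.+1)%:R -
    lam * sig * (y i.+1 - y i) * (j == i)%:R).
  apply: eq_bigr => i _; rewrite tm !dot_hard_dir /= !ortho ?ltnS ?(ltnW (ltn_ord i)) //.
  rewrite /hard_coef ![(_ == j)%N]eq_sym /y; field.
  by [].
have -> : \sum_(i < T) dot (u j) ((hard_coef (inr (inr i)) *
    hard_tower (inr (inr i)) 1 (dot (hard_dir (inr (inr i))) x)) *: hard_dir (inr (inr i))) =
   \sum_(i < T) lam * sig * (nu * ups r 1 (y i)) * (j == i)%:R.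
  apply: eq_bigr => i _; rewrite tm !dot_hard_dir /= !ortho ?ltnS ?(ltnW (ltn_ord i)) //.
  rewrite /hard_coef ![(_ == j)%N]eq_sym /y [sig^-1 * _]mulrC; field.
  by [].
have pick (F : 'I_T -> R) : \sum_(i < T) F i * (j == i)%:R = F (Ordinal jT).
  rewrite (bigD1 (Ordinal jT)) //= eqxx mulr1 big1 ?addr0 // => i ij.
  by rewrite eq_sym (negbTE (_ : (i : nat) != j)) ?mulr0.
rewrite big_split /= sumrN !pick /=.
rewrite tm !dot_hard_dir /= ortho // /hard_coef.
have -> : \sum_(i < T) lam * sig * (y i.+1 - y i) * (j == i.+1)%:R =
   lam * sig * (if j is j'.+1 then y j - y j' else 0).
  case: j jT {jT' pick tm} => [|j'] jT.
    by rewrite mulr0 big1 // => i _; rewrite mulr0.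
  have jT' : (j' < T)%N by exact: ltnW.
  rewrite (bigD1 (Ordinal jT')) //= eqxx mulr1 big1 ?addr0 // => i ij.
  by rewrite eqSS eq_sym (negbTE (_ : (i : nat) != j')) ?mulr0.
rewrite /resid /slope; case: j jT {jT' pick tm} => [|j'] jT /=.
  by rewrite /y; field.
by rewrite /y; field.
Qed.

Lemma enorm_grad_hard x : (lam * sig) ^+ 2 *
   (\sum_(0 <= j < T) resid a (fun i => dot (u i) x / sig)
      (fun i => nu * ups r 1 (dot (u i) x / sig)) j ^+ 2) <= enorm (grad hard x) ^+ 2.
Proof.
rewrite enormE sqr_sqrtr ?dot_ge0 //.
apply: (@le_trans _ _ (\sum_(i < T) dot (u i) (grad hard x) ^+ 2)).
  rewrite big_mkord mulr_sumr; apply: ler_sum => i _.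
  by rewrite dot_grad_hard // [leRHS]exprMn.
by apply: bessel => i j iT jT; apply: ortho; exact: ltnW.
Qed.

End Hard.

(** If y_j = 0 for all j >= s, the value and the gradient at x do not depend on the
    vectors u_i with i > s: the corresponding terms have zero derivative. *)
Lemma hard_agree (R : realType) d T (u u' : nat -> 'rV[R]_d) lam sig a nu r x s :
  0 < r ->
  (forall i, (i <= s)%N -> u i = u' i) ->
  (forall i, (s <= i)%N -> dot (u i) x = 0) ->
  (forall i, (s <= i)%N -> dot (u' i) x = 0) ->
  hard T u lam sig a nu r x = hard T u' lam sig a nu r x /\
  grad (hard T u lam sig a nu r) x = grad (hard T u' lam sig a nu r) x.
Proof.
move=> r0 uu' u0 u0'.
have duu' i : dot (u i) x = dot (u' i) x.
  by have [/uu' -> //|/ltnW h] := leqP i s; rewrite u0 ?u0'.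
have ddir k : dot (hard_dir u sig k) x = dot (hard_dir u' sig k) x.
  by case: k => [k|[k|k]]; rewrite /hard_dir !dotZl ?dotBl !duu'.
split; first by apply: eq_bigr => k _; rewrite ddir.
rewrite /hard !grad_ridge; try exact: hard_towerP.
apply: eq_bigr => k _; rewrite ddir.
case: k => [k|[k|k]]; rewrite /hard_dir /=.
- by rewrite uu'.
- have [ks|sk] := ltnP k s; first by rewrite !uu' // ltnW.
  by rewrite dotZl dotBl !u0' ?(leqW sk) // !subr0 !mulr0 !scale0r.
- have [ks|sk] := ltnP k s; first by rewrite !uu' // ltnW.
  by rewrite dotZl !u0' // mulr0 ups1_0 // mulr0 !scale0r.
Qed.

(** In the same situation, the gradient vanishes on the coordinates on which
    u_0, ..., u_s vanish. *)
Lemma grad_hard_coord (R : realType) d T (u : nat -> 'rV[R]_d) lam sig a nu r x s j :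
  0 < r ->
  (forall i, (i <= s)%N -> u i 0 j = 0) ->
  (forall i, (s <= i)%N -> dot (u i) x = 0) ->
  grad (hard T u lam sig a nu r) x 0 j = 0.
Proof.
move=> r0 uj u0; rewrite /hard grad_ridge; last exact: hard_towerP.
rewrite summxE big1 // => -[k|[k|k]] _; rewrite !mxE /hard_dir /= !dotZl.
- by rewrite uj // !mulr0.
- have [ks|sk] := ltnP k s.
    by rewrite !uj ?subrr ?mulr0 // ltnW.
  by rewrite dotBl !u0 ?(leqW sk) // !subr0 !mulr0 mul0r.
- have [ks|sk] := ltnP k s; first by rewrite uj ?mulr0 // ltnW.
  by rewrite u0 // mulr0 ups1_0 // mulr0 mul0r.
Qed.

(** * Resisting oracle *)

Lemma exists_orthogonal_unit (R : realType) d (vs : seq 'rV[R]_d) : (size vs < d)%N ->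
  exists v, dot v v = 1 /\ forall w, w \in vs -> dot w v = 0.
Proof.
move=> vsd; pose M : 'M[R]_(d, size vs) := \matrix_(i, j) (nth 0 vs j) 0 i.
have k0 : kermx M != 0.
  rewrite kermx_eq0; apply/negP => /eqP rM.
  by have := rank_leq_col M; rewrite rM leqNgt vsd.
pose v := nz_row (kermx M).
have v0 : v != 0 by rewrite nz_row_eq0.
have vM : v *m M = 0 by apply/sub_kermxP; exact: nz_row_sub.
have wv w : w \in vs -> dot w v = 0.
  move=> wvs; have iw : (index w vs < size vs)%N by rewrite index_mem.
  have /rowP /(_ (Ordinal iw)) := vM; rewrite !mxE => h; rewrite -[RHS]h.
  by apply: eq_bigr => j _; rewrite !mxE /= nth_index // mulrC.
have vv : 0 < dot v v.
  rewrite lt_neqAle dot_ge0 andbT eq_sym; apply: contra v0 => /eqP /dot_eq0 ->.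
  exact: eqxx.
exists ((Num.sqrt (dot v v))^-1 *: v); split=> [|w /wv h]; last by rewrite dotZr h mulr0.
rewrite dotZl dotZr mulrA -invfM -expr2 sqr_sqrtr ?ltW // mulVf //.
by rewrite gt_eqF.
Qed.

Lemma oracle_history_eq (R : realType) d (f f' : 'rV[R]_d -> R) (x x' : nat -> 'rV[R]_d) i :
  (forall s, (s < i)%N -> [/\ x s = x' s, f (x s) = f' (x s) & grad f (x s) = grad f' (x s)]) ->
  oracle_history f x i = oracle_history f' x' i.
Proof.
move=> h; apply/row_matrixP => s; rewrite !rowK.
by have [e1 e2 e3] := h s (ltn_ord s); rewrite e2 e3 e1.
Qed.

(** Induction on the number k of vectors already chosen, the others being zero.
    The hypothesis [agree] says that the answer at a point orthogonal to all u_i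
    with i >= s depends on u_0, ..., u_s only.  The new vector is orthogonal to the
    k old ones and to the first k + 1 iterates, whence the bound on k. *)
Lemma det_resisting_frame (R : realType) (A : algorithm R) d
    (f : (nat -> 'rV[R]_d.+1) -> 'rV[R]_d.+1 -> R) : @Adet R A ->
  (forall u x, differentiable (f u) x) ->
  (forall u u' x s, (forall i, (i <= s)%N -> u i = u' i) ->
     (forall i, (s <= i)%N -> dot (u i) x = 0) ->
     (forall i, (s <= i)%N -> dot (u' i) x = 0) ->
     f u x = f u' x /\ grad (f u) x = grad (f u') x) ->
  forall k, (k.*2 <= d.+1)%N -> exists u : nat -> 'rV[R]_d.+1,
  [/\ forall i j, (i < k)%N -> (j < k)%N -> dot (u i) (u j) = (i == j)%:R,
      forall i, (k <= i)%N -> u i = 0 &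
      forall s, (s < k)%N -> forall j, (s <= j)%N -> dot (u j) (A d (f u) s) = 0].
Proof.
move=> hA df agree; have [phi [_ hphi]] := hA d.
have {}hphi u i : A d (f u) i = phi i (oracle_history (f u) (A d (f u)) i).
  by apply: hphi => x; exact: df.
elim=> [|k IH] kd; first by exists (fun=> 0); split.
have [|u [ortho uz ux]] := IH; first by rewrite doubleS in kd; lia.
move: (A d (f u)) (hphi u) ux => X hX ux.
have [|v [v1 vo]] := @exists_orthogonal_unit R d.+1
    ([seq u i | i <- iota 0 k] ++ [seq X i | i <- iota 0 k.+1]).
  rewrite size_cat !size_map !size_iota; rewrite doubleS in kd; lia.
have vu i : (i < k)%N -> dot (u i) v = 0.
  move=> ik; apply: vo; rewrite mem_cat; apply/orP; left.
  by apply/mapP; exists i => //; rewrite mem_iota.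
have vX i : (i <= k)%N -> dot (X i) v = 0.
  move=> ik; apply: vo; rewrite mem_cat; apply/orP; right.
  by apply/mapP; exists i => //; rewrite mem_iota.
pose u' i := if i == k then v else u i.
have u'X s j : (s <= k)%N -> (s <= j)%N -> dot (u' j) (X s) = 0.
  move=> sk sj; rewrite /u'; case: (eqVneq j k) => [_|jk]; first by rewrite dotC vX.
  move: sk; rewrite leq_eqVlt => /predU1P[sk|sk]; last exact: ux.
  rewrite uz ?dot0l //; by rewrite -sk.
(* The iterates up to k are the same for u and u'. *)
have same s : (s <= k)%N -> A d (f u') s = X s.
  elim/ltn_ind: s => s IHs sk.
  apply: etrans (hphi u' s) _; apply: etrans _ (esym (hX s)); congr (phi s _).
  apply: oracle_history_eq => i si.
  have ik : (i < k)%N by exact: leq_trans si sk.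
  have [|||hf hg] := agree u u' (X i) i.
  - move=> l li; rewrite /u'; case: (eqVneq l k) => // lk.
    by move: ik; rewrite -lk ltnNge li.
  - by move=> l il; exact: ux.
  - by move=> l il; apply: u'X => //; exact: ltnW.
  by rewrite IHs ?(ltnW ik).
exists u'; split.
- move=> i j; rewrite !ltnS /u' => ik jk.
  case: (eqVneq i k) => [iE|ink]; case: (eqVneq j k) => [jE|jnk].
  + by rewrite v1 iE jE eqxx.
  + by rewrite dotC vu ?ltn_neqAle ?jnk // iE eq_sym (negbTE jnk).
  + by rewrite vu ?ltn_neqAle ?ink // jE (negbTE ink).
  + by rewrite ortho // ltn_neqAle ?ink ?jnk.
- by move=> i ki; rewrite /u' gtn_eqF // uz // ltnW.
- by move=> s sk j sj; rewrite same // u'X.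
Qed.

Lemma resisting_frame (R : realType) (A : algorithm R) (T : nat) (lam sig a nu r : R) :
  0 < r -> (@Adet R `|` @Azr R) A ->
  exists d (u : nat -> 'rV[R]_d.+1),
  (forall i j, (i < T.+1)%N -> (j < T.+1)%N -> dot (u i) (u j) = (i == j)%:R) /\
  forall s, (s < T)%N -> forall j, (s <= j)%N ->
    dot (u j) (A d (hard T u lam sig a nu r) s) = 0.
Proof.
move=> r0 [] hA.
  have df (u : nat -> 'rV[R]_T.*2.+2) x : differentiable (hard T u lam sig a nu r) x.
    exact: differentiable_hard.
  have [|u [h1 _ h3]] := det_resisting_frame hA df _ (k := T.+1) (leqnn _).
    by move=> u u' x s; exact: hard_agree.
  by exists T.*2.+1, u; split => // s sT j sj; apply: h3 => //; exact: ltnW.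
pose u i : 'rV[R]_T.+1 := if (i < T.+1)%N then delta_mx 0 (inord i) else 0.
exists T, u; split.
  move=> i j iT jT; rewrite /u iT jT dot_delta mxE eqxx /=.
  by rewrite -val_eqE /= !inordK // eq_sym.
have fd x : differentiable (hard T u lam sig a nu r) x by exact: differentiable_hard.
elim/ltn_ind => s IHs sT j sj.
have [jT|Tj] := ltnP j T.+1; last by rewrite /u ltnNge Tj dot0l.
rewrite {1}/u jT dotC dot_delta; apply/eqP/negPn/negP => xj.
have /fintype.subsetP /(_ (inord j)) := hA T _ fd s.
rewrite inE xj => /(_ isT) /bigcupP[i _]; rewrite inE => /eqP; apply.
apply: (@grad_hard_coord R _ T u lam sig a nu r _ i) => // [l li|l il]; last first.
  by apply: IHs => //; exact: ltn_trans (ltn_ord i) sT.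
have lj : (l < j)%N by exact: leq_ltn_trans li (leq_trans (ltn_ord i) sj).
have lT : (l < T.+1)%N by exact: ltn_trans jT.
by rewrite /u lT mxE /= -val_eqE /= !inordK // gtn_eqF.
Qed.

(** A lower bound for admissible parameters.  For T = 0 it only says that the
    complexity is at least 1, and no condition on the accuracy is needed. *)
Lemma complexity_ge (R : realType) (p : nat) (Delta eps : R) (L : nat -> R)
    (T : nat) (lam sig b nu r : R) :
  0 < lam -> 0 < sig -> 0 < b <= 1 -> 0 <= nu -> 1 <= r -> nu * r ^+ 2 <= 1 ->
  8 * lam <= L 1%N ->
  (forall q, (2 <= q.+1 <= p)%N -> 3 * lam * nu * r ^+ 2 / (r * sig) ^+ q <= L q.+1) ->
  lam * sig ^+ 2 * (b ^+ 2 / 2 + 11 * nu * T%:R) <= Delta ->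
  0 <= eps -> ((0 < T)%N -> eps <= lam * sig * b ^+ 3 / 64 ^+ 2) ->
  nu = b ^+ 4 \/ nu = 0 /\ T%:R * b ^+ 2 <= 1 ->
  ((T.+1%:R)%:E <= complexity eps (@Adet R `|` @Azr R) (@fclass R p Delta L))%E.
Proof.
move=> lam0 sig0 /andP[b0 b1] nu0 r1 nur L1 Lq hD eps0 heps hnu.
have r0 : 0 < r by exact: lt_le_trans r1.
have a0 : 0 < b ^+ 2 by exact: exprn_gt0.
have a1 : b ^+ 2 <= 1 by rewrite expr_le1 // ltW.
apply/ereal_infP => _ [A hA <-].
have [d [u [ortho hx]]] := resisting_frame T lam sig (b ^+ 2) nu r0 hA.
set f := hard _ _ _ _ _ _ _ in hx.
have fF : fclass p Delta L f by apply: hard_fclass => //; rewrite (ltW a0).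
apply: (@le_trans _ _ (Teps eps f (A d f))); last first.
  by apply: ereal_sup_ubound; exists (existT (fun d => 'rV[R]_d.+1 -> R) d f).
apply/ereal_infP => _ [t /= ht <-].
rewrite lee_fin ler_nat ltnS leqNgt; apply/negP => tT.
have {}heps := heps (leq_ltn_trans (leq0n t) tT).
have hy := hx t tT.
pose y i := dot (u i) (A d f t) / sig.
pose W i := nu * ups r 1 (y i).
have S_le : \sum_(0 <= i < T) resid (b ^+ 2) y W i ^+ 2 <= 64^-1 ^+ 4 * (b ^+ 2) ^+ 3.
  have ls0 : 0 < (lam * sig) ^+ 2 by rewrite exprn_gt0 // mulr_gt0.
  rewrite -(ler_pM2l ls0); apply: le_trans (enorm_grad_hard _ _ _ _ _ ortho _) _ => //.
  have : enorm (grad f (A d f t)) ^+ 2 <= (lam * sig * b ^+ 3 / 64 ^+ 2) ^+ 2.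
    by rewrite lerXn2r ?nnegrE ?sqrtr_ge0 ?(le_trans ht) // (le_trans eps0).
  move/le_trans; apply; rewrite le_eqVlt; apply/orP; left; apply/eqP.
  by field.
have y0 i : (t <= i)%N -> y i = 0 by move=> ti; rewrite /y hy // mul0r.
clear hx fF ortho hy hD ht.
clearbody y; clear f.
case: T @W y0 S_le tT hnu u => [//|T] W y0 S_le tT hnu _.
have a01 : 0 < b ^+ 2 <= 1 by rewrite a0 a1.
have yT : y T = 0 by exact: y0.
have yT1 : y T.+1 = 0 by apply: y0; exact: leqW.
case: hnu => [nuE|[nuE Tb]].
  apply: (@chain_nonlinear R _ y W T a01 yT yT1 S_le (ups r 1)).
  - by move=> i; rewrite /W nuE -exprM.
  - by move=> x; exact: ups1_le0.
  - by move=> x; exact: ups1_window.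
  - by move=> x; exact: ups1_left.
apply: (@chain_quadratic R _ y W T a01 yT yT1 S_le) => // i.
by rewrite /W nuE mul0r.
Qed.

(** * Choice of the parameters *)

Section Regimes.
Variables (R : realType) (p : nat) (Delta eps : R) (L : nat -> R).
Hypothesis p2 : (2 <= p)%N.
Hypothesis Delta0 : 0 < Delta.
Hypothesis eps0 : 0 < eps.
Hypothesis L0 : forall q, (1 <= q <= p)%N -> 0 < L q.

Let L1_gt0 : 0 < L 1%N. Proof. by apply: L0; rewrite /= ltnW. Qed.

(** The convex quadratic chain, with a = 2 64^2 eps / sqrt (L_1 Delta) and T the
    integer part of 1/a.  If a > 1, the bound is less than 1. *)
Lemma complexity_ge_convex :
  ((Num.sqrt (L 1%N * Delta) / (2 * 64 ^+ 2 * eps))%:E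
     <= complexity eps (@Adet R `|` @Azr R) (@fclass R p Delta L))%E.
Proof.
have l0 := L1_gt0.
set S : R := 64 ^+ 2; have S0 : 0 < S by exact: exprn_gt0.
pose w := Num.sqrt (L 1%N * Delta).
have w0 : 0 < w by rewrite sqrtr_gt0 mulr_gt0.
have w2 : w ^+ 2 = L 1%N * Delta by rewrite sqr_sqrtr // ltW // mulr_gt0.
have LqT (q : nat) (s : R) : (2 <= q.+1 <= p)%N ->
    3 * (L 1%N / 8) * 0 * 1 ^+ 2 / (1 * s) ^+ q <= L q.+1.
  by move=> hq; rewrite mulr0 !mul0r ltW // L0 // (ltnW (proj1 (andP hq))) (proj2 (andP hq)).
have lam0 : 0 < L 1%N / 8 by rewrite divr_gt0.
pose x := w / (2 * S * eps).
have x0 : 0 < x by rewrite divr_gt0 // !mulr_gt0.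
rewrite -/w -/x.
have [x1|x1] := leP 1 x; last first.
  apply: (@le_trans _ _ 1%:E); first by rewrite lee_fin ltW.
  apply: (@complexity_ge R p Delta eps L 0 (L 1%N / 8)
    (Num.sqrt (Delta / (L 1%N / 8))) 1 0 1) => //.
  - by rewrite sqrtr_gt0 divr_gt0.
  - by rewrite ltr01 lexx.
  - by rewrite mulrC divfK.
  - move=> q hq; exact: LqT.
  - rewrite sqr_sqrtr; last by rewrite ltW // divr_gt0.
    rewrite [_ * (Delta / _)]mulrC divfK ?gt_eqF // expr1n !mulr0 ?mulr0n ?mulr0 addr0.
    by have := Delta0; lra.
  - exact: ltW.
  - by right; split => //; rewrite mulr0n mul0r.
have [n1 n2] : (Num.truncn x)%:R <= x /\ x < (Num.truncn x).+1%:R.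
  by have /andP[] := truncn_itv (ltW x0).
apply: (@le_trans _ _ ((Num.truncn x).+1%:R)%:E); first by rewrite lee_fin ltW.
pose b := Num.sqrt x^-1.
have b2 : b ^+ 2 = x^-1 by rewrite sqr_sqrtr // invr_ge0 ltW.
have b0 : 0 < b by rewrite sqrtr_gt0 invr_gt0.
have b1 : b <= 1 by rewrite -(@expr_le1 _ 2) ?(ltW b0) // b2 invf_le1.
apply: (@complexity_ge R p Delta eps L (Num.truncn x) (L 1%N / 8)
  (S * eps / (L 1%N / 8 * b ^+ 3)) b 0 1) => //.
- by rewrite divr_gt0 // !mulr_gt0 // exprn_gt0.
- by rewrite b0 b1.
- by rewrite mulrC divfK.
- move=> q hq; exact: LqT.
- have -> : L 1%N / 8 * (S * eps / (L 1%N / 8 * b ^+ 3)) ^+ 2 *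
      (b ^+ 2 / 2 + 11 * 0 * (Num.truncn x)%:R) = 4 * S ^+ 2 * eps ^+ 2 / (L 1%N * (b ^+ 2) ^+ 2).
    by field; rewrite !gt_eqF.
  rewrite b2 /x (_ : _ / _ = w ^+ 2 / L 1%N).
    by rewrite w2 mulrC mulKf ?gt_eqF.
  by field; rewrite !gt_eqF.
- exact: ltW.
- move=> _; rewrite -/S le_eqVlt; apply/orP; left; apply/eqP.
  by field; rewrite !gt_eqF.
- right; split => //; rewrite b2 ler_pdivrMr // mul1r.
  exact: n1.
Qed.

(** The numerical constant of both lower bounds; 64^-2 is the constant of the lower
    bound for the gradient of the chain, and 176 = 16 * 11 with -11 the lower bound
    of the potential. *)
Definition rate_const : R := 1 / (176 * (64 ^+ 2) ^+ 2).

(** The chain with nu = a^2 = b^4, unless the first node alone uses up more than half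
    of Delta, in which case the convex bound is larger. *)
Lemma complexity_ge_rate b r : 0 < b <= 1 -> 1 <= r -> r * b ^+ 2 <= 1 ->
  (forall q, (2 <= q.+1 <= p)%N ->
     3 * (L 1%N / 8) * b ^+ 4 * r ^+ 2 /
       (r * (64 ^+ 2 * eps / (L 1%N / 8 * b ^+ 3))) ^+ q <= L q.+1) ->
  ((rate_const * Delta * (L 1%N * b ^+ 2 / eps ^+ 2))%:E
     <= complexity eps (@Adet R `|` @Azr R) (@fclass R p Delta L))%E.
Proof.
move=> /andP[b0 b1] r1 rb hq; rewrite /rate_const.
have l0 := L1_gt0.
set S : R := 64 ^+ 2 in hq *; have S0 : 0 < S by exact: exprn_gt0.
have b40 : 0 < b ^+ 4 by exact: exprn_gt0.
have [small|big] := leP (Delta * L 1%N * b ^+ 4) (8 * S ^+ 2 * eps ^+ 2).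
  apply: le_trans complexity_ge_convex; rewrite lee_fin -/S.
  pose w := Num.sqrt (L 1%N * Delta); rewrite -/w.
  have w0 : 0 < w by rewrite sqrtr_gt0 mulr_gt0.
  have w2 : w ^+ 2 = L 1%N * Delta by rewrite sqr_sqrtr // ltW // mulr_gt0.
  have h : w * b ^+ 2 <= 3 * S * eps.
    rewrite -(@ler_pXn2r _ 2) ?nnegrE ?mulr_ge0 ?exprn_ge0 ?(ltW b0) ?(ltW w0) ?(ltW S0) ?(ltW eps0) //.
    rewrite exprMn w2 -exprM; apply: le_trans (_ : 8 * S ^+ 2 * eps ^+ 2 <= _).
      by rewrite [L 1%N * _]mulrC.
    rewrite !exprMn !ler_wpM2r ?sqr_ge0 //.
    rewrite -natrX ler_nat //.
  have e1 : 1 / (176 * S ^+ 2) * Delta * (L 1%N * b ^+ 2 / eps ^+ 2) =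
     w / (176 * S ^+ 2 * eps ^+ 2) * (w * b ^+ 2).
    rewrite [RHS](_ : _ = w ^+ 2 * b ^+ 2 / (176 * S ^+ 2 * eps ^+ 2)); last first.
      by field; rewrite !gt_eqF.
    by rewrite w2; field; rewrite !gt_eqF.
  rewrite e1; apply: (@le_trans _ _ (w / (176 * S ^+ 2 * eps ^+ 2) * (3 * S * eps))).
    by rewrite ler_pM2l // divr_gt0 // !mulr_gt0 // exprn_gt0.
  rewrite [leLHS](_ : _ = w / (2 * S * eps) * (6 / 176)); last by field; rewrite !gt_eqF.
  by rewrite ler_piMr ?divr_ge0 ?mulr_ge0 ?(ltW w0) ?(ltW S0) ?(ltW eps0) //; lra.
pose x := 1 / (176 * S ^+ 2) * Delta * (L 1%N * b ^+ 2 / eps ^+ 2); rewrite -/x.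
have x0 : 0 < x by rewrite !mulr_gt0 ?invr_gt0 ?mulr_gt0 ?exprn_gt0.
have [n1 n2] : (Num.truncn x)%:R <= x /\ x < (Num.truncn x).+1%:R.
  by have /andP[] := truncn_itv (ltW x0).
apply: (@le_trans _ _ ((Num.truncn x).+1%:R)%:E); first by rewrite lee_fin ltW.
apply: (@complexity_ge R p Delta eps L (Num.truncn x) (L 1%N / 8)
  (S * eps / (L 1%N / 8 * b ^+ 3)) b (b ^+ 4) r) => //.
- by rewrite divr_gt0.
- by rewrite divr_gt0 // !mulr_gt0 ?invr_gt0 // exprn_gt0.
- by rewrite b0 b1.
- exact: ltW.
- rewrite (_ : _ * _ = (r * b ^+ 2) ^+ 2); last by ring.
  by rewrite expr_le1 // mulr_ge0 ?exprn_ge0 ?(ltW b0) // (le_trans ler01).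
- by rewrite mulrC divfK.
- have -> : L 1%N / 8 * (S * eps / (L 1%N / 8 * b ^+ 3)) ^+ 2 *
      (b ^+ 2 / 2 + 11 * b ^+ 4 * (Num.truncn x)%:R) =
      4 * S ^+ 2 * eps ^+ 2 / (L 1%N * b ^+ 4) +
      88 * S ^+ 2 * eps ^+ 2 / (L 1%N * b ^+ 2) * (Num.truncn x)%:R.
    by field; rewrite !gt_eqF.
  have h1 : 4 * S ^+ 2 * eps ^+ 2 / (L 1%N * b ^+ 4) <= Delta / 2.
    by rewrite ler_pdivrMr ?mulr_gt0 //; lra.
  have h2 : 88 * S ^+ 2 * eps ^+ 2 / (L 1%N * b ^+ 2) * (Num.truncn x)%:R <=
      88 * S ^+ 2 * eps ^+ 2 / (L 1%N * b ^+ 2) * x.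
    by rewrite ler_pM2l // divr_gt0 // !mulr_gt0 // exprn_gt0.
  have h3 : 88 * S ^+ 2 * eps ^+ 2 / (L 1%N * b ^+ 2) * x = Delta / 2.
    by rewrite /x; field; rewrite !gt_eqF.
  lra.
- exact: ltW.
- move=> _; rewrite -/S le_eqVlt; apply/orP; left; apply/eqP.
  by field; rewrite !gt_eqF.
- by left.
Qed.

End Regimes.

(** * Exponents *)

(* All quantities are positive; the identities and inequalities between their
   powers are linear in the logarithms. *)

Lemma powR_gt0E (R : realType) (x y : R) : 0 < x -> x `^ y = expR (y * ln x).
Proof. by move=> x0; rewrite /powR gt_eqF. Qed.

(** With b^2 = m eps^(2/5) / L_1, a bound of m by the term of index q + 2 gives the
    smoothness condition of order q + 2 for r = b^(-2). *)
Lemma rate_exponent_gen (R : realType) (q : nat) (L1 Lq eps m : R) :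
  0 < L1 -> 0 < Lq -> 0 < eps -> 0 < m ->
  m <= L1 `^ (3 / 5 - 2 / (5 * (q.+2%:R - 1))) * Lq `^ (2 / (5 * (q.+2%:R - 1))) ->
  L1 * (L1 * expR ((ln m + 2 / 5 * ln eps - ln L1) / 2) ^+ 5 / eps) ^+ q.+1 <= Lq.
Proof.
have ln_ex x : 0 < x -> exists y, x = expR y :> R by move=> x0; exists (ln x); rewrite lnK.
move=> /ln_ex[X ->] /ln_ex[Y ->] /ln_ex[E ->] /ln_ex[M ->].
rewrite !powR_gt0E ?expR_gt0 // !expRK -expRD ler_expR => h.
have q1 : q.+2%:R - 1 = q.+1%:R :> R by rewrite -[q.+2%:R]natr1 addrK.
rewrite q1 in h; set N : R := q.+1%:R in h.
have N0 : 0 < N by rewrite ltr0n.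
have {}h : N * M * 5 <= (3 * N - 2) * X + 2 * Y.
  have : N * 5 * M <= N * 5 * ((3 / 5 - 2 / (5 * N)) * X + 2 / (5 * N) * Y).
    by rewrite ler_pM2l // mulr_gt0.
  rewrite (_ : N * 5 * (_ + _) = (3 * N - 2) * X + 2 * Y); first lra.
  by field; rewrite gt_eqF.
rewrite -expRM_natl -expRN -!expRD -expRM_natl -expRD ler_expR -/N.
lra.
Qed.

Lemma rate_value_gen (R : realType) (L1 eps m : R) : 0 < L1 -> 0 < eps -> 0 < m ->
  L1 * expR ((ln m + 2 / 5 * ln eps - ln L1) / 2) ^+ 2 / eps ^+ 2 = m * eps `^ (- (8 / 5)).
Proof.
have ln_ex x : 0 < x -> exists y, x = expR y :> R by move=> x0; exists (ln x); rewrite lnK.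
move=> /ln_ex[X ->] /ln_ex[E ->] /ln_ex[M ->].
rewrite powR_gt0E ?expR_gt0 // !expRK -!expRM_natl -expRN -!expRD.
by congr expR; field.
Qed.

Lemma rate_value_two (R : realType) (L1 L2 eps : R) : 0 < L1 -> 0 < eps -> 0 < L2 ->
  L1 * expR ((ln eps + ln L2 - 2 * ln L1) / 7) ^+ 2 / eps ^+ 2 =
  L1 `^ (3 / 7) * L2 `^ (2 / 7) * eps `^ (- (12 / 7)).
Proof.
have ln_ex x : 0 < x -> exists y, x = expR y :> R by move=> x0; exists (ln x); rewrite lnK.
move=> /ln_ex[X ->] /ln_ex[E ->] /ln_ex[Y ->].
rewrite !powR_gt0E ?expR_gt0 // !expRK -!expRM_natl -expRN -!expRD.
by congr expR; field.
Qed.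

Lemma ln_accuracy_le (R : realType) (L1 L2 eps : R) : 0 < L1 -> 0 < L2 -> 0 < eps ->
  eps <= (L1 ^+ 2 / L2) `^ (1 / (2 - 1)) -> ln eps + ln L2 <= 2 * ln L1.
Proof.
move=> L10 L20 eps0.
rewrite (_ : 1 / (2 - 1) = 1); last by field.
rewrite powRr1 ?(ltW (divr_gt0 (exprn_gt0 2 L10) L20)) // ler_pdivlMr // => h.
rewrite -lnM ?posrE // mulr_natl -lnXn // ler_ln ?posrE ?mulr_gt0 ?exprn_gt0 //.
Qed.

(** * The lower bounds *)

Theorem theorem2 (R : realType) :
  exists (c C : R) (l : nat -> R),
    [/\ 0 < c, 0 < C,
        (forall q : nat, (1 <= q)%N ->
          0 < l q /\
          l q <= expR (3 * q%:R / 2 * ln (q%:R : R) + C * q%:R)) &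
        forall (p : nat) (Delta : R) (L : nat -> R) (eps : R),
          (2 <= p)%N -> 0 < Delta ->
          (forall q : nat, (1 <= q <= p)%N -> 0 < L q) ->
          0 < eps ->
          (forall q : nat, (2 <= q <= p)%N ->
            eps <= (L 1%N ^+ q / L q) `^ (1 / (q%:R - 1))) ->
          let F := fun q : nat =>
            (L 1%N / l 1%N) `^ (3 / 5 - 2 / (5 * (q%:R - 1))) *
            (L q / l q) `^ (2 / (5 * (q%:R - 1))) in
          (* F 2 is one of the terms, so it is harmless as initial value *)
          ((c * Delta * (\big[Num.min/F 2%N]_(2 <= q < p.+1) F q) *
              eps `^ (- (8 / 5)))%:E
            <= complexity eps (@Adet R `|` @Azr R) (@fclass R p Delta L))%E
          /\
          (p = 2%N ->
           ((c * Delta * (L 1%N / l 1%N) `^ (3 / 7) * (L 2%N / l 2%N) `^ (2 / 7) *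
               eps `^ (- (12 / 7)))%:E
             <= complexity eps (@Adet R `|` @Azr R) (@fclass R 2 Delta L))%E)].
Proof.
have S0 : 0 < 64 ^+ 2 :> R by exact: exprn_gt0.
exists (rate_const R), 1, (fun=> 1); split.
- by rewrite divr_gt0 // mulr_gt0 // exprn_gt0.
- exact: ltr01.
- move=> q q1; split; first exact: ltr01.
  have lnq : 0 <= ln (q%:R : R) by rewrite ln_ge0 // ler1n.
  rewrite mul1r -[leLHS]expR0 ler_expR; apply: addr_ge0 => //.
  by apply: mulr_ge0 => //; apply: divr_ge0 => //; exact: mulr_ge0.
move=> p Delta L eps p2 Delta0 L0 eps0 epsL F.
have L10 : 0 < L 1%N by apply: L0; rewrite /= ltnW.
have L20 : 0 < L 2%N by apply: L0; rewrite /= p2.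
have Xeps : ln eps + ln (L 2%N) <= 2 * ln (L 1%N).
  by apply: ln_accuracy_le => //; apply: epsL; rewrite p2.
have Fgt0 q : (1 <= q <= p)%N -> 0 < F q.
  by move=> hq; rewrite /F !divr1 mulr_gt0 // powR_gt0 // L0.
split.
  set m := \big[_/_]_(_ <= _ < _) _.
  have m0 : 0 < m.
    rewrite /m big_seq; apply: lt_bigmin; first by rewrite Fgt0.
    move=> q; rewrite mem_index_iota => /andP[q2 qp].
    by apply: Fgt0; rewrite (ltnW q2) -ltnS.
  have mF q : (2 <= q <= p)%N -> m <= F q.
    by move=> hq; apply: ge_bigmin_seq => //; rewrite mem_index_iota ltnS.
  set b := expR ((ln m + 2 / 5 * ln eps - ln (L 1%N)) / 2).
  have b0 : 0 < b by exact: expR_gt0.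
  have b1 : b <= 1.
    rewrite -expR0 ler_expR.
    have := mF 2%N; rewrite leqnn p2 => /(_ isT).
    rewrite /F !divr1 -ler_ln ?posrE ?mulr_gt0 ?powR_gt0 // lnM ?posrE ?powR_gt0 //.
    rewrite !ln_powR (_ : 2 - 1 = 1) ?mulr1; last by ring.
    by lra.
  have b2 : b ^+ 2 <= 1 by rewrite expr_le1 // ltW.
  rewrite -mulrA -(rate_value_gen L10 eps0 m0).
  apply: (complexity_ge_rate p2 Delta0 eps0 L0 (r := (b ^+ 2)^-1)).
  - by rewrite b0 b1.
  - by rewrite invf_ge1 // exprn_gt0.
  - by rewrite mulVf // gt_eqF // exprn_gt0.
  case=> [|q] hq; first by move: hq.
  have hL := rate_exponent_gen L10 (L0 q.+2 hq) eps0 m0.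
  have := mF q.+2 hq; rewrite /F !divr1 => /hL; rewrite -/b; apply: le_trans.
  rewrite (_ : (b ^+ 2)^-1 * _ = (L 1%N * b ^+ 5 / eps / (8 * 64 ^+ 2))^-1); last first.
    by field; rewrite !gt_eqF.
  rewrite [_^-1 ^+ q.+1]exprVn invrK (_ : 3 * _ * _ * _ = L 1%N * (3 / 8)); last first.
    by field; rewrite gt_eqF.
  rewrite -mulrA ler_pM2l // expr_div_n.
  set z := (_ * _ / _) ^+ _.
  have z0 : 0 <= z by rewrite exprn_ge0 // divr_ge0 ?mulr_ge0 ?exprn_ge0 ?ltW.
  have d1 : 1 <= (8 * 64 ^+ 2) ^+ q.+1 :> R by rewrite exprn_ege1 //; lra.
  apply: (@le_trans _ _ (1 * z)); last by rewrite mul1r.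
  apply: ler_pM => //; first by rewrite divr_ge0 // ltW // (lt_le_trans ltr01).
  - lra.
  - by rewrite ler_pdivrMr ?ler_peMr // (lt_le_trans ltr01).
move=> pE; rewrite {}pE in p2 L0 epsL *; rewrite !divr1.
set b := expR ((ln eps + ln (L 2%N) - 2 * ln (L 1%N)) / 7).
have b0 : 0 < b by exact: expR_gt0.
have b1 : b <= 1 by rewrite -expR0 ler_expR; lra.
have b7 : b ^+ 7 = eps * L 2%N / L 1%N ^+ 2.
  rewrite -expRM_natl -[eps in RHS]lnK // -[L 2%N in RHS]lnK // -[L 1%N in RHS]lnK //.
  by rewrite -expRM_natl -expRN -!expRD; congr expR; field.
rewrite -2!(mulrA (rate_const R * Delta)) -(rate_value_two L10 eps0 L20).
apply: (complexity_ge_rate p2 Delta0 eps0 L0 (r := 1)) => //.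
- by rewrite b0 b1.
- by rewrite mul1r expr_le1 // ltW.
case=> [|[|q]] hq //.
rewrite expr1 -/b (_ : _ / _ = b ^+ 7 * (L 1%N ^+ 2 * (3 / 64) / (64 ^+ 2 * eps))); last first.
  by field; rewrite !gt_eqF.
rewrite b7 (_ : _ * _ = L 2%N * (3 / 64 / 64 ^+ 2)); last by field; rewrite !gt_eqF.
by rewrite ler_piMr ?(ltW L20) //; lra.
Qed.
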